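(* Let $n\ge 2$ and let $\theta$ be a real anti-symmetric $n\times n$ matrix. For every smoothing operator $R\in\Psi^{-\infty}(\mathbb{T}^n_\theta)$ such that $\operatorname{Tr}(R)=0$ there are operators $R_1,\dots,R_4$ in $\Psi^{-\infty}(\mathbb{T}^n_\theta)$ such that $R=[R_1,R_2]+[R_3,R_4]$.
   Context: Let $n\ge 2$ and let $\theta=(\theta_{jk})$ be a real anti-symmetric $n\times n$ matrix with columns $\theta_1,\dots,\theta_n$. On $L^2(\mathbb{T}^n)$, $\mathbb{T}^n=\mathbb{R}^n/2\pi\mathbb{Z}^n$ (normalized measure), let $U_j$ be the unitary $(U_j\xi)(x)=e^{ix_j}\xi(x+\pi\theta_j)$, so $U_kU_j=e^{2i\pi\theta_{jk}}U_jU_k$. Put $U^k=U_1^{k_1}\cdots U_n^{k_n}$, $k\in\mathbb{Z}^n$. $A_\theta$ is the $C^*$-algebra generated by $U_1,\dots,U_n$; $\tau$ is its continuous tracial state with $\tau(1)=1$, $\tau(U^k)=0$ for $k\ne0$; $\mathcal{H}_\theta$ is the Hilbert space completion of $A_\theta$ for $\langle u|v\rangle=\tau(uv^* )$, with orthonormal basis $(U^k)_{k\in\mathbb{Z}^n}$. The group $\mathbb{R}^n$ acts on $A_\theta$ by $\alpha_s(U^k)=e^{is\cdot k}U^k$; $\mathcal{A}_\theta$ is the algebra of smooth elements of this action, equivalently $\mathcal{A}_\theta=\{\sum_k u_kU^k:(u_k)\text{ rapidly decaying}\}$, with the Fréchet topology of the semi-norms $u\mapsto\|\delta_1^{\beta_1}\cdots\delta_n^{\beta_n}u\|$,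 where $\delta_j$ are the derivations with $\delta_j(U^k)=k_jU^k$. $\mathcal{A}_\theta'$ is the strong dual of $\mathcal{A}_\theta$, in which $\mathcal{A}_\theta$ is densely embedded. A linear operator $R:\mathcal{A}_\theta\to\mathcal{A}_\theta'$ is smoothing if its range is contained in $\mathcal{A}_\theta$ and it extends to a continuous linear map $\mathcal{A}_\theta'\to\mathcal{A}_\theta$. $\Psi^{-\infty}(\mathbb{T}^n_\theta)$ is the class of smoothing operators. Smoothing operators extend to trace-class operators on $\mathcal{H}_\theta$, and $\operatorname{Tr}$ is the usual operator trace. *)

(* Defs.v *)
From HB Require Import structures.
From mathcomp Require Import all_boot all_order all_algebra.
From mathcomp Require Import all_classical all_reals all_analysis.
From mathcomp Require Import complex.
From mathcomp Require Import ring lra.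

Set Implicit Arguments.
Unset Strict Implicit.
Unset Printing Implicit Defensive.
Import Order.TTheory GRing.Theory Num.Theory.
Import numFieldNormedType.Exports.
Import ComplexField.Normc.

Local Open Scope classical_set_scope.
Local Open Scope ring_scope.

Notation Zn n := {ffun 'I_n -> int}.

Definition box (n N : nat) : set (Zn n) :=
  [set k | forall j : 'I_n, (`|k j| <= N)%N].

(* Every family to which [sumZ] is applied below is absolutely summable, so
   summing over cubes gives the unordered sum. *)
Definition sumZ (R : realType) (n : nat) (f : Zn n -> R[i]) : R[i] :=
  lim ((fun N : nat => \sum_(k \in box N) f k : R[i]^o) @ \oo).

Definition rapidly_decaying (R : realType) (n : nat) (u : Zn n -> R[i]^o) :
    Prop :=
  forall m : nat, exists M : R, forall k : Zn n,
    (1 + \sum_(j < n) `|k j|%N%:R) ^+ m * normc (u k) <= M.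

(* e^{it} *)
Definition expi (R : realType) (t : R) : R[i] := (cos t +i* sin t)%C.

(* Tuples carry the product Borel sigma-algebra.  Functions on the torus
   T^n = R^n / 2 pi Z^n are the 2 pi Z^n-periodic functions on R^n. *)
Notation Rn R n := (n.-tuple (measurableTypeR R)).

Fact two_pi_gt0 (R : realType) : 0 < 2 * pi :> R.
Proof. by rewrite mulr_gt0 ?pi_gt0. Qed.

Definition Rn_cons (R : realType) (n : nat) (p : measurableTypeR R * Rn R n) :
  Rn R n.+1 := [the n.+1.-tuple (measurableTypeR R) of p.1 :: p.2].

Fact measurable_Rn_cons (R : realType) (n : nat) :
  measurable_fun [set: measurableTypeR R * Rn R n] (@Rn_cons R n).
Proof.
by apply: (@measurable_cons _ _ _ _ fst n snd);
  [exact: measurable_fst | exact: measurable_snd].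
Qed.

HB.instance Definition _ (R : realType) (n : nat) :=
  isMeasurableFun.Build _ _ _ _ _ (@measurable_Rn_cons R n).

(* The n-fold product of the normalized Lebesgue measure of [0, 2 pi], i.e. the
   normalized measure of T^n read on a fundamental domain. *)
Fixpoint torus_measure (R : realType) (n : nat) : probability (Rn R n) R :=
  match n return probability (Rn R n) R with
  | 0%N => \d_([tuple] : Rn R 0)
  | m.+1 => distribution (uniform_prob (two_pi_gt0 R) \x torus_measure R m)%E
              (@Rn_cons R m)
  end.

Definition Rn_translate (R : realType) (n : nat) (x : Rn R n) (v : 'cV[R]_n) :
    Rn R n :=
  [tuple tnth x i + v i 0 | i < n].

Definition periodic (R : realType) (n : nat) (xi : Rn R n -> R[i]) : Prop :=
  forall (x : Rn R n) (k : Zn n),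
    xi (Rn_translate x (\col_i (2 * pi * (k i)%:~R))) = xi x.

Definition L2norm (R : realType) (n : nat) (xi : Rn R n -> R[i]) : \bar R :=
  Lnorm (torus_measure R n) 2%:E (fun x => (normc (xi x))%:E).

Definition L2 (R : realType) (n : nat) (xi : Rn R n -> R[i]) : Prop :=
  [/\ periodic xi,
      measurable_fun setT (fun x => complex.Re (xi x) : measurableTypeR R),
      measurable_fun setT (fun x => complex.Im (xi x) : measurableTypeR R) &
      (L2norm xi < +oo)%E].

(* Operator norm on L^2(T^n): elements of L^2 are handled through their
   representatives, so no quotient by a.e. equality is needed. *)
Definition opnorm (R : realType) (n : nat)
    (T : (Rn R n -> R[i]) -> (Rn R n -> R[i])) : R :=
  sup [set fine (L2norm (T xi)) | xi in [set xi | L2 xi /\ (L2norm xi <= 1)%E]].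

(* U_j, with theta_j the j-th column of theta *)
Definition Ugen (R : realType) (n : nat) (theta : 'M[R]_n) (j : 'I_n)
    (xi : Rn R n -> R[i]) : Rn R n -> R[i] :=
  fun x => expi (tnth x j) * xi (Rn_translate x (pi *: col j theta)).

Definition Ugen_inv (R : realType) (n : nat) (theta : 'M[R]_n) (j : 'I_n)
    (xi : Rn R n -> R[i]) : Rn R n -> R[i] :=
  fun x => let y := Rn_translate x (- (pi *: col j theta)) in
    expi (- tnth y j) * xi y.

Definition Upow (R : realType) (n : nat) (theta : 'M[R]_n) (j : 'I_n) (m : int)
    (xi : Rn R n -> R[i]) : Rn R n -> R[i] :=
  match m with
  | Posz p => iter p (Ugen theta j) xi
  | Negz p => iter p.+1 (Ugen_inv theta j) xi
  end.

(* U^k = U_1^{k_1} ... U_n^{k_n}, in this order *)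
Definition Umon (R : realType) (n : nat) (theta : 'M[R]_n) (k : Zn n) :
    (Rn R n -> R[i]) -> (Rn R n -> R[i]) :=
  \big[(fun S T => S \o T)/id]_(j <- enum 'I_n) Upow theta j (k j).

(* An element sum_k u_k U^k of the algebra is encoded by the family (u_k) of its
   coefficients.  For rapidly decaying u the series converges in operator norm
   since the U^k are unitary, so the C*-norm of its sum (its norm as an operator
   on L^2(T^n)) is the limit of the norms of its partial sums. *)
Definition cstar_norm (R : realType) (n : nat) (theta : 'M[R]_n)
    (u : Zn n -> R[i]) : R :=
  lim ((fun N : nat =>
          opnorm (fun xi x => \sum_(k \in box N) u k * Umon theta k xi x)) @ \oo).

(* The structure constants of the algebra, U^k U^l = cocycle k l . U^{k+l};
   this is proved below as [Umon_mul]. *)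
Definition cocycle (R : realType) (n : nat) (theta : 'M[R]_n) (k l : Zn n) :
    R[i] :=
  expi (2 * pi * \sum_(a < n) \sum_(b < n | (a < b)%N)
                    theta a b * (l a)%:~R * (k b)%:~R).

Lemma expiD (R : realType) (s t : R) : expi (s + t) = expi s * expi t.
Proof.
by rewrite /expi cosD sinD; apply/eqP; rewrite eq_complex /= addrC (mulrC (sin s)) eqxx addrC eqxx.
Qed.

Lemma tnth_translate (R : realType) (n : nat) (x : Rn R n) (v : 'cV[R]_n) i :
  tnth (Rn_translate x v) i = tnth x i + v i 0.
Proof. by rewrite tnth_mktuple. Qed.

Lemma translateD (R : realType) (n : nat) (x : Rn R n) (v w : 'cV[R]_n) :
  Rn_translate (Rn_translate x v) w = Rn_translate x (v + w).
Proof. by apply: eq_from_tnth => i; rewrite !tnth_translate mxE addrA. Qed.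

Lemma translate0 (R : realType) (n : nat) (x : Rn R n) : Rn_translate x 0 = x.
Proof. by apply: eq_from_tnth => i; rewrite !tnth_translate mxE addr0. Qed.

Lemma Ugen_invK (R : realType) (n : nat) (theta : 'M[R]_n) j :
  cancel (Ugen_inv theta j) (Ugen theta j).
Proof.
move=> xi; apply/funext => x; rewrite /Ugen /Ugen_inv translateD subrr translate0.
by rewrite mulrA -expiD subrr /expi cos0 sin0 mul1r.
Qed.

Lemma UgenK (R : realType) (n : nat) (theta : 'M[R]_n) j :
  cancel (Ugen theta j) (Ugen_inv theta j).
Proof.
move=> xi; apply/funext => x; rewrite /Ugen /Ugen_inv translateD addNr translate0.
by rewrite mulrA -expiD addNr /expi cos0 sin0 mul1r.
Qed.

Section Umon_mul.
Context (R : realType) (n : nat) (theta : 'M[R]_n).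
Context (theta_asym : theta^T = - theta).

Lemma asymE a b : theta a b = - theta b a.
Proof. by have /matrixP/(_ b a) := theta_asym; rewrite !mxE. Qed.

Lemma theta_diag a : theta a a = 0.
Proof. by have := asymE a a; lra. Qed.

Lemma UpowE j m xi x : Upow theta j m xi x =
  expi (m%:~R * tnth x j) * xi (Rn_translate x ((m%:~R * pi) *: col j theta)).
Proof.
case: m => p.
  rewrite /Upow; elim: p x => [|p IH] x.
    by rewrite /= !mul0r scale0r translate0 /expi cos0 sin0 mul1r.
  rewrite -[LHS]/(Ugen theta j (iter p (Ugen theta j) xi) x) {1}/Ugen IH translateD tnth_translate !mxE theta_diag mulr0 addr0.
  rewrite mulrA -expiD -scalerDl -!pmulrn -natr1.
  by congr (expi _ * xi (Rn_translate _ (_ *: _))); ring.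
rewrite -[LHS]/(iter p.+1 (Ugen_inv theta j) xi x) NegzE; elim: p.+1 x => {p}[|p IH] x.
  by rewrite /= oppr0 !mul0r scale0r translate0 /expi cos0 sin0 mul1r.
rewrite -[LHS]/(Ugen_inv theta j (iter p (Ugen_inv theta j) xi) x) {1}/Ugen_inv IH translateD !tnth_translate !mxE theta_diag mulr0 oppr0 addr0.
rewrite mulrA -expiD -scaleNr -scalerDl !mulrNz -!pmulrn -natr1.
by congr (expi _ * xi (Rn_translate _ (_ *: _))); ring.
Qed.

Let pairs (k l : Zn n) (s : seq 'I_n) : R :=
  \sum_(a <- s) \sum_(b <- s | (a < b)%N) theta a b * (l a)%:~R * (k b)%:~R.

Lemma UprodE (k : Zn n) (s : seq 'I_n) xi x :
  sorted (fun a b : 'I_n => (a < b)%N) s ->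
  (\big[(fun S T => S \o T)/id]_(j <- s) Upow theta j (k j)) xi x =
  expi (\sum_(j <- s) (k j)%:~R * tnth x j - pi * pairs k k s) *
  xi (Rn_translate x (\sum_(j <- s) ((k j)%:~R * pi) *: col j theta)).
Proof.
elim: s x => [|a s IH] x /= ss.
  by rewrite /pairs !big_nil mulr0 subr0 translate0 /expi cos0 sin0 mul1r.
have lts b : b \in s -> (a < b)%N.
  by move: ss => /order_path_min -/(_ (fun x y z => @ltn_trans x y z)) /allP; apply.
rewrite big_cons /= UpowE IH ?(path_sorted ss)// translateD.
rewrite mulrA -expiD; congr (expi _ * xi (Rn_translate _ _)); last by rewrite big_cons.
rewrite /pairs [X in _ = X - _]big_cons [in RHS]big_cons [X in pi * (X + _)]big_cons ltnn.
have -> : \sum_(b <- s | (a < b)%N) theta a b * (k a)%:~R * (k b)%:~R =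
          \sum_(b <- s) theta a b * (k a)%:~R * (k b)%:~R.
  by rewrite big_seq_cond [RHS]big_seq; apply: eq_bigl => b; case: (boolP (b \in s)) => // /lts ->.
have -> : \sum_(i <- s) \sum_(b <- a :: s | (i < b)%N) theta i b * (k i)%:~R * (k b)%:~R =
          \sum_(i <- s) \sum_(b <- s | (i < b)%N) theta i b * (k i)%:~R * (k b)%:~R.
  rewrite !big_seq; apply: eq_bigr => i /lts ai; rewrite big_cons.
  by rewrite ltnNge (ltnW ai).
have -> : \sum_(j <- s) (k j)%:~R * tnth (Rn_translate x (((k a)%:~R * pi) *: col a theta)) j =
   \sum_(j <- s) (k j)%:~R * tnth x j - pi * \sum_(b <- s) theta a b * (k a)%:~R * (k b)%:~R.
  rewrite mulr_sumr -sumrB; apply: eq_bigr => j _.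
  by rewrite tnth_translate !mxE (asymE j a); ring.
ring.
Qed.

Lemma UmonE (k : Zn n) xi x : Umon theta k xi x =
  expi (\sum_j (k j)%:~R * tnth x j -
        pi * \sum_(a < n) \sum_(b < n | (a < b)%N) theta a b * (k a)%:~R * (k b)%:~R) *
  xi (Rn_translate x (\sum_j ((k j)%:~R * pi) *: col j theta)).
Proof.
rewrite /Umon UprodE; last first.
  rewrite -(@sorted_map _ _ (@nat_of_ord n) ltn) val_enum_ord; exact: iota_ltn_sorted.
rewrite /pairs !big_enum /=; congr (expi (_ - pi * _) * _).
by apply: eq_bigr => a _; rewrite big_enum_cond.
Qed.

Lemma Umon_mul (k l : Zn n) xi :
  Umon theta k (Umon theta l xi) = (fun x => cocycle theta k l * Umon theta (k + l) xi x).
Proof.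
apply/funext => x; rewrite !UmonE translateD !mulrA -!expiD.
congr (expi _ * xi (Rn_translate _ _)); last first.
  by rewrite -big_split; apply: eq_bigr => j _; rewrite /= ffunE intrD mulrDl scalerDl.
have -> : \sum_j (l j)%:~R * tnth (Rn_translate x (\sum_i ((k i)%:~R * pi) *: col i theta)) j =
  \sum_j (l j)%:~R * tnth x j + pi * \sum_i \sum_j theta j i * (l j)%:~R * (k i)%:~R.
  rewrite exchange_big mulr_sumr -big_split; apply: eq_bigr => j _ /=.
  rewrite tnth_translate summxE mulrDr !mulr_sumr; congr (_ + _).
  by apply: eq_bigr => i _; rewrite !mxE; ring.
pose Q (k l : Zn n) := \sum_(a < n) \sum_(b < n | (a < b)%N) theta a b * (k a)%:~R * (l b)%:~R.
have full : \sum_i \sum_j theta j i * (l j)%:~R * (k i)%:~R = Q l k - Q k l.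
  rewrite exchange_big /=.
  transitivity (Q l k + \sum_(a < n) \sum_(b < n | (b < a)%N) theta a b * (l a)%:~R * (k b)%:~R).
    rewrite -big_split; apply: eq_bigr => a _ /=.
    rewrite (bigID (fun b : 'I_n => (a < b)%N)) /=; congr (_ + _).
    rewrite (bigD1 a) ?ltnn//= theta_diag !mul0r add0r; apply: eq_bigl => b.
    by rewrite -leqNgt ltn_neqAle andbC.
  congr (_ + _); rewrite /Q (exchange_big_dep xpredT) //= -sumrN; apply: eq_bigr => a _.
  by rewrite -sumrN; apply: eq_bigr => b _; rewrite (asymE b a); ring.
have QD : Q (k + l) (k + l) = Q k k + Q k l + Q l k + Q l l.
  rewrite /Q -!big_split; apply: eq_bigr => a _; rewrite -!big_split.
  by apply: eq_bigr => b _; rewrite /= !ffunE !intrD; ring.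
have XD : \sum_j ((k + l) j)%:~R * tnth x j =
    \sum_j (k j)%:~R * tnth x j + \sum_j (l j)%:~R * tnth x j.
  by rewrite -big_split; apply: eq_bigr => j _; rewrite /= ffunE intrD mulrDl.
by rewrite full -/(Q k k) -/(Q l l) -/(Q (k + l) (k + l)) -/(Q l k) QD XD; ring.
Qed.
End Umon_mul.

Lemma Ugen_comm (R : realType) (n : nat) (theta : 'M[R]_n) (theta_asym : theta^T = - theta)
    (j k : 'I_n) xi :
  Ugen theta k (Ugen theta j xi) =
  (fun x => expi (2 * pi * theta j k) * Ugen theta j (Ugen theta k xi) x).
Proof.
apply/funext => x; rewrite /Ugen !translateD [in RHS]addrC !tnth_translate !mxE.
by rewrite (asymE theta_asym k j) !mulrA -!expiD; congr (expi _ * _); ring.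
Qed.

(* Neighbourhood filters of the locally convex topology defined by the family of
   semi-norms p. *)
Definition seminorm_nbhs (R : realType) (E : zmodType) (I : Type) (p : I -> E -> R)
    (x : E) : set_system E :=
  [set V | exists (m : nat) (i : 'I_m -> I) (e : R),
     0 < e /\ [set y | forall j, p (i j) (y - x) < e] `<=` V].

Definition rapid_pred (R : realType) (n : nat) : {pred (Zn n -> R[i]^o)} :=
  [pred u | `[< rapidly_decaying u >]].

Lemma rapid_submod_closed (R : realType) (n : nat) : submod_closed (@rapid_pred R n).
Proof.
split.
  apply/asboolP => m; exists 0 => k; rewrite normc0 mulr0 //.
move=> a u v /asboolP du /asboolP dv; apply/asboolP => m.
have [M HM] := du m; have [L HL] := dv m; exists (normc a * M + L) => k.
set w := (_ ^+ m); have w0 : 0 <= w.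
  by rewrite exprn_ge0// addr_ge0// sumr_ge0// => j _; rewrite ler0n.
apply: (@le_trans _ _ (w * (normc a * normc (u k) + normc (v k)))).
  by rewrite ler_wpM2l// -normcM; exact: le_normcD.
rewrite mulrDr lerD ?HL// mulrCA ler_wpM2l ?HM//.
by rewrite /normc; case: (a) => ? ?; rewrite sqrtr_ge0.
Qed.

HB.instance Definition _ (R : realType) (n : nat) :=
  GRing.isSubmodClosed.Build R[i] (Zn n -> R[i]^o) (@rapid_pred R n)
    (@rapid_submod_closed R n).

(* The smooth noncommutative torus {sum_k u_k U^k | (u_k) rapidly decaying}.
   theta does not constrain the coefficients, but it determines the product, the
   involution and the semi-norms, hence the topology. *)
Record smooth (R : realType) (n : nat) (theta : 'M[R]_n) := Smooth {
  coef :> Zn n -> R[i]^o ;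
  coef_rapid : coef \in @rapid_pred R n }.

HB.instance Definition _ R n theta := [isSub for @coef R n theta].
HB.instance Definition _ R n theta := [Choice of @smooth R n theta by <:].
HB.instance Definition _ R n theta := [SubChoice_isSubLmodule of @smooth R n theta by <:].

(* || delta_1^{beta_1} ... delta_n^{beta_n} u ||, with delta_j U^k = k_j U^k *)
Definition smooth_seminorm (R : realType) (n : nat) (theta : 'M[R]_n)
    (beta : {ffun 'I_n -> nat}) (u : smooth theta) : R :=
  cstar_norm theta (fun k => (\prod_(j < n) (k j)%:~R ^+ beta j) * u k).

HB.instance Definition _ R n theta :=
  hasNbhs.Build (@smooth R n theta) (seminorm_nbhs (@smooth_seminorm R n theta)).

(* The trace: tau(1) = 1 and tau(U^k) = 0 for k <> 0. *)
Definition tau (R : realType) (n : nat) (u : Zn n -> R[i]) : R[i] := u 0.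

(* (sum_k u_k U^k) (sum_l v_l U^l) *)
Definition tmul (R : realType) (n : nat) (theta : 'M[R]_n) (u v : Zn n -> R[i]) :
    Zn n -> R[i] :=
  fun m => sumZ (fun k => cocycle theta k (m - k) * u k * v (m - k)).

(* (sum_k u_k U^k)^*; as U^k is unitary, [Umon_mul] gives
   (U^k)^* = (U^k)^{-1} = (cocycle k (-k))^{-1} U^{-k}, and cocycle k (-k) has
   modulus one. *)
Definition tstar (R : realType) (n : nat) (theta : 'M[R]_n) (u : Zn n -> R[i]) :
    Zn n -> R[i] :=
  fun m => ((cocycle theta (- m) m * u (- m))^*)%C.

Definition inner (R : realType) (n : nat) (theta : 'M[R]_n) (u v : Zn n -> R[i]) : R[i] :=
  tau (tmul theta u (tstar theta v)).

Definition dual_pred (R : realType) (n : nat) (theta : 'M[R]_n) :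
    {pred (smooth theta -> R[i]^o)} :=
  [pred f : smooth theta -> R[i]^o | `[< linear f /\ continuous f >]].

#[global] Instance seminorm_nbhs_filter (R : realType) (E : zmodType) (I : Type)
    (p : I -> E -> R) (x : E) : Filter (seminorm_nbhs p x).
Proof.
split.
- by exists 0%N, (fun i : 'I_0 => match notF (ltn_ord i) with end), 1.
- move=> V W [m [i [e [e0 Ve]]]] [m' [i' [e' [e'0 We]]]].
  exists (m + m')%N, (fun j => match fintype.split j with inl a => i a | inr b => i' b end),
    (Num.min e e'); split; first by rewrite lt_min e0.
  move=> y /= H; split.
    apply: Ve => j /=; have := H (lshift m' j); rewrite (unsplitK (inl j)).
    by move=> /lt_le_trans; apply; rewrite ge_min lexx.
  apply: We => j /=; have := H (rshift m j); rewrite (unsplitK (inr j)).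
  by move=> /lt_le_trans; apply; rewrite ge_min lexx orbT.
- move=> V W VW [m [i [e [e0 Ve]]]]; exists m, i, e; split=> //.
  exact: subset_trans VW.
Qed.

Lemma dual_submod_closed (R : realType) (n : nat) (theta : 'M[R]_n) :
  submod_closed (@dual_pred R n theta).
Proof.
split.
  apply/asboolP; split; first by move=> a u v; rewrite /= scaler0 addr0.
  by move=> u; apply: cvg_cst.
move=> a f g /asboolP[lf cf] /asboolP[lg cg]; apply/asboolP; split.
  move=> b u v; rewrite /= !fctE lf lg !scalerDr !scalerA (mulrC a b).
  by rewrite -!addrA; congr (_ + _); rewrite addrCA.
by move=> u; apply: cvgD; [apply: cvgZr; exact: cf | exact: cg].
Qed.

HB.instance Definition _ (R : realType) (n : nat) (theta : 'M[R]_n) :=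
  GRing.isSubmodClosed.Build R[i] (smooth theta -> R[i]^o) (@dual_pred R n theta)
    (@dual_submod_closed R n theta).

(* Topological dual, with the strong topology defined below *)
Record smooth_dual (R : realType) (n : nat) (theta : 'M[R]_n) := SmoothDual {
  dual_fun :> smooth theta -> R[i]^o ;
  dual_funP : dual_fun \in @dual_pred R n theta }.

HB.instance Definition _ R n theta := [isSub for @dual_fun R n theta].
HB.instance Definition _ R n theta := [Choice of @smooth_dual R n theta by <:].
HB.instance Definition _ R n theta :=
  [SubChoice_isSubLmodule of @smooth_dual R n theta by <:].

(* Bounded subsets of the locally convex space [smooth theta] *)
Definition smooth_bounded (R : realType) (n : nat) (theta : 'M[R]_n)
    (B : set (smooth theta)) : Prop :=
  forall beta, exists M : R, forall u, B u -> smooth_seminorm beta u <= M.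

Definition strong_seminorm (R : realType) (n : nat) (theta : 'M[R]_n)
    (B : {B : set (smooth theta) | smooth_bounded B}) (f : smooth_dual theta) : R :=
  sup [set normc (f u) | u in sval B].

HB.instance Definition _ R n theta :=
  hasNbhs.Build (@smooth_dual R n theta) (seminorm_nbhs (@strong_seminorm R n theta)).

(* f is the image of u under the embedding u |-> tau(u .) of the algebra in its
   dual. *)
Definition represents (R : realType) (n : nat) (theta : 'M[R]_n)
    (f : smooth_dual theta) (u : smooth theta) : Prop :=
  forall v : smooth theta, f v = tau (tmul theta u v).

(* T maps the algebra to its dual, its range is contained in the algebra, and it
   extends to a continuous linear map S from the strong dual to the algebra; both
   the argument and the value of S are compared with those of T through the
   embedding [represents]. *)
Definition smoothing (R : realType) (n : nat) (theta : 'M[R]_n)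
    (T : {linear smooth theta -> smooth_dual theta}) : Prop :=
  (forall u, exists w, represents (T u) w) /\
  (exists2 S : {linear smooth_dual theta -> smooth theta}, continuous S &
     forall u f, represents f u -> represents (T u) (S f)).

(* T seen as an operator from the algebra to itself.  The vector represented by
   T u exists when T is smoothing, and it is unique. *)
Definition corestr (R : realType) (n : nat) (theta : 'M[R]_n)
    (T : {linear smooth theta -> smooth_dual theta}) (u : smooth theta) : smooth theta :=
  xget 0 [set w | represents (T u) w].

(* [S, T] = S T - T S, again as a map from the algebra to its dual *)
Definition commutator (R : realType) (n : nat) (theta : 'M[R]_n)
    (S T : {linear smooth theta -> smooth_dual theta}) (u : smooth theta) :
    smooth_dual theta :=
  S (corestr T u) - T (corestr S u).

Lemma Ubasis_rapid (R : realType) (n : nat) (k : Zn n) :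
  (fun l : Zn n => (l == k)%:R : R[i]^o) \in @rapid_pred R n.
Proof.
apply/asboolP => m; exists ((1 + \sum_(j < n) `|k j|%N%:R) ^+ m) => l.
have [->|_] := eqVneq l k; first by rewrite normc1 mulr1.
by rewrite normc0 mulr0 exprn_ge0// addr_ge0// sumr_ge0// => j _; rewrite ler0n.
Qed.

(* U^k as an element of the algebra *)
Definition Ubasis (R : realType) (n : nat) (theta : 'M[R]_n) (k : Zn n) : smooth theta :=
  Smooth theta (Ubasis_rapid R k).

(* Operator trace on the Hilbert space of tau, computed in its orthonormal basis
   (U^k): sum_k < T U^k | U^k >.  The vectors T U^k stay in the algebra, so the
   completion does not have to be formed. *)
Definition Tr (R : realType) (n : nat) (theta : 'M[R]_n)
    (T : {linear smooth theta -> smooth_dual theta}) : R[i] :=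
  sumZ (fun k => inner theta (corestr T (Ubasis theta k)) (Ubasis theta k)).

(* Main.v *)
Require Import Defs.
From HB Require Import structures.
From mathcomp Require Import all_boot all_order all_algebra.
From mathcomp Require Import all_classical all_reals all_analysis.
From mathcomp Require Import measurable_realfun.
From mathcomp Require Import complex.
From mathcomp Require Import ring lra zify.
Set Implicit Arguments.
Unset Strict Implicit.
Unset Printing Implicit Defensive.
Import Order.TTheory GRing.Theory Num.Theory.
Import numFieldNormedType.Exports.
Import ComplexField.Normc.
Local Open Scope classical_set_scope.
Local Open Scope ring_scope.

(** In the orthonormal basis [U^k] an operator [T] is the matrix [t k l], the
    [k]-th coefficient of [T U^l], and smoothing operators are the matrices that
    decay rapidly in both indices; the trace is the sum of the diagonal.  So the
    claim concerns an infinite matrix [t] with rapidly decaying entries and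
    trace zero.

    The diagonal is removed by one commutator of operators of rank one.  Factor
    the sequence equal to [t k k] for [k <> 0] and to [0] for [k = 0] as [x k * y k],
    both factors being of the size of the square root.  The column [C] with
    entries [x k] in position [(k, 0)] and the row [E] with entries [y l] in
    position [(0, l)] satisfy [CE = x y^T], with diagonal [x k * y k], and
    [EC = <y, x>] in position [(0, 0)] only; as the trace vanishes,
    [<y, x> = - t 0 0], so [CE - EC] has the diagonal of [t]
    ([trace_zero_commutators]).

    What remains is a matrix [r] with zero diagonal, and [r = [D, B]] with [D]
    diagonal as soon as [r k l = (d k - d l) * b k l].  Dividing by [d k - d l]
    must not destroy the decay, so [d] is chosen to decay more slowly than [r]:
    it is the sequence of tails of a sum, along a total order of the lattice, of
    terms that bound the square roots of the entries of [r].  Then [b] is of the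
    size of the square root of [r] ([zero_diagonal_commutator]).

    The rest of the work is the dictionary between operators and matrices.  The
    C*-norm of [sum_k u_k U^k] lies between each [|u_k|] and [sum_k |u_k|]
    ([coef_le_cstar_norm], [cstar_norm_le]): the upper bound holds because the
    [U^k] are isometries of L2, by translation invariance of the measure of the
    torus, and the lower bound is a bound on Fourier coefficients
    ([coef_le_L2norm]).  So the topology of the algebra is given by the weighted
    sup norms of the coefficients ([nbhs_smoothP]), and the continuity of the
    extension of [T] to the strong dual amounts to the rapid decay of the matrix
    ([smoothing_matrix], [matrix_smoothing]). *)

(** * Invariance of the torus measure under translations *)

Lemma lebesgue_measure_translate (R : realType) (v : R) (A : set R) :
  measurable A ->
  pushforward lebesgue_measure ((fun x => x + v) : _ -> measurableTypeR R) A =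
  lebesgue_measure A.
Proof.
move=> mA.
apply/esym/lebesgue_measure_unique => //=; first exact: measurable_funD.
move=> _ _ [[a b]] _ <-; rewrite /pushforward.
have -> : (fun x : R => x + v) @^-1` `]a, b] = `]a - v, b - v]%classic.
  by apply/seteqP; split => x /=; rewrite !in_itv/= ltrBlDr lerBrDr.
by rewrite !lebesgue_measure_itv/= !lte_fin ltrD2r -!EFinB opprB addrA subrK.
Qed.

(** Change of variables for the pushforward of the Lebesgue measure. *)
Lemma integral_preimage_translate (R : realType) (v : R) (D : set R)
    (f : measurableTypeR R -> \bar R) :
  measurable D -> measurable_fun setT f -> (forall x, (0 <= f x)%E) ->
  (\int[lebesgue_measure]_(x in (fun x => (x + v)%R) @^-1` D) f (x + v)%R =
   \int[lebesgue_measure]_(x in D) f x)%E.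
Proof.
move=> mD mf f0.
have mv : measurable_fun setT
    ((fun x => x + v) : measurableTypeR R -> measurableTypeR R).
  exact: measurable_funD.
rewrite -(@ge0_integral_pushforward _ _ (measurableTypeR R) (measurableTypeR R) R _
  mv lebesgue_measure)//=.
  by apply: eq_measure_integral => //= A mA _; exact: lebesgue_measure_translate.
exact: measurable_funTS.
Qed.

(** Modulo the period the translation may be taken in [0, p[; it then moves the
    part of the interval lying in [0, r[ to its other end, where periodicity
    gives the same integral. *)
Lemma integral_period_translate (R : realType) (f : measurableTypeR R -> \bar R)
    (p v : R) :
  0 < p -> measurable_fun setT f -> (forall x, (0 <= f x)%E) ->
  (forall x (k : int), f (x + p * k%:~R) = f x) ->
  (\int[lebesgue_measure]_(x in `[0%R, p]) f (x + v)%R =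
   \int[lebesgue_measure]_(x in `[0%R, p]) f x)%E.
Proof.
move=> p0 mf f0 fp.
pose q := Num.floor (v / p); pose r := v - p * q%:~R.
have fr x : f (x + v) = f (x + r) by rewrite -[RHS](fp _ q) /r addrA subrK.
have r0 : 0 <= r.
  by rewrite /r subr_ge0 mulrC -ler_pdivlMr// ge_floor.
have rp : r < p.
  rewrite /r ltrBlDr -[X in X + _]mulr1 -mulrDr mulrC -ltr_pdivrMr//.
  by have := floorD1_gt (v / p); rewrite intrD addrC.
under eq_integral do rewrite fr.
have mfr w : measurable_fun setT (fun x : measurableTypeR R => f (x + w)).
  by apply: measurableT_comp => //; exact: measurable_funD.
have mI (a b : R) : measurable (`[a, b[ : set (measurableTypeR R)).
  exact: measurable_itv.
have shift w (a b : R) :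
    (\int[lebesgue_measure]_(x in `[a, b[) f (x + w)%R =
     \int[lebesgue_measure]_(x in `[(a + w)%R, (b + w)%R[) f x)%E.
  rewrite -[RHS](integral_preimage_translate w)//; congr integral.
  by apply/seteqP; split => x /=; rewrite !in_itv/= lerD2r ltrD2r.
have split_itv (a b c : R) : a <= b -> b <= c ->
    (\int[lebesgue_measure]_(x in `[a, c[) f x =
     \int[lebesgue_measure]_(x in `[a, b[) f x +
     \int[lebesgue_measure]_(x in `[b, c[) f x)%E.
  move=> ab bc; rewrite -ge0_integral_setU//=.
  - congr integral; apply/seteqP; split => x /=; rewrite !in_itv/=.
      by move=> /andP[ax xc]; case: (ltP x b) => xb; [left|right]; apply/andP.
    move=> [|] /andP[h1 h2]; apply/andP; split=> //.
      exact: lt_le_trans bc.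
    exact: le_trans h1.
  - exact: measurable_funTS.
  - apply/disj_setPS => x [] /=; rewrite !in_itv/= => /andP[_ h] /andP[h' _].
    by have := lt_le_trans h h'; rewrite ltxx.
rewrite -[LHS]integral_itv_bndo_bndc; last exact: (measurable_funTS (mfr r)).
rewrite -[RHS]integral_itv_bndo_bndc; last exact: (measurable_funTS mf).
rewrite shift add0r (split_itv r p); [|exact: ltW|by rewrite lerDl].
rewrite (split_itv 0 r p)//; last exact: ltW.
rewrite addeC; congr (_ + _)%E.
rewrite -{1}(add0r p) (addrC p r) -shift; apply: eq_integral => x _.
by rewrite -[RHS](fp x 1) mulr1.
Qed.

Lemma measurable_translate (R : realType) (n : nat) (v : 'cV[R]_n) :
  measurable_fun setT ((fun x => Rn_translate x v) : Rn R n -> Rn R n).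
Proof.
apply/measurable_fun_tnthP => i.
rewrite (_ : _ \o _ = fun x : Rn R n => tnth x i + v i 0).
  by apply: measurable_funD => //; exact: measurable_tnth.
by apply/funext => x /=; rewrite tnth_translate.
Qed.

Lemma translate_cons (R : realType) (n : nat) (v : 'cV[R]_n.+1) p :
  Rn_translate (@Rn_cons R n p) v =
  Rn_cons (p.1 + v 0 0, Rn_translate p.2 (\col_i v (lift ord0 i) 0)).
Proof.
apply: eq_from_tnth => i; rewrite tnth_translate.
case: (unliftP ord0 i) => [j ->|->].
  by rewrite !tnthS/= tnth_translate mxE.
by rewrite !tnth0.
Qed.

Lemma torus_integral_cons (R : realType) (n : nat) (f : Rn R n.+1 -> \bar R) :
  measurable_fun setT f -> (forall x, (0 <= f x)%E) ->
  (\int[torus_measure R n.+1]_x f x =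
   \int[(uniform_prob (two_pi_gt0 R) \x torus_measure R n)%E]_p f (Rn_cons p))%E.
Proof.
by move=> mf f0; rewrite [torus_measure _ _]/= ge0_integral_distribution.
Qed.

Lemma torus_integral_translate (R : realType) (n : nat) (f : Rn R n -> \bar R)
    (v : 'cV[R]_n) :
  measurable_fun setT f -> (forall x, (0 <= f x)%E) ->
  (forall x (k : Zn n), f (Rn_translate x (\col_i (2 * pi * (k i)%:~R))) = f x) ->
  (\int[torus_measure R n]_x f (Rn_translate x v) =
   \int[torus_measure R n]_x f x)%E.
Proof.
elim: n f v => [|n IH] f v mf f0 fp.
  by apply: eq_integral => x _; congr f; apply: eq_from_tnth => -[].
have mft w : measurable_fun setT (fun x : Rn R n.+1 => f (Rn_translate x w)).
  by apply: measurableT_comp => //; exact: measurable_translate.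
have mc : measurable_fun setT (fun p => f (@Rn_cons R n p)).
  by apply: measurableT_comp => //; exact: measurable_Rn_cons.
rewrite !torus_integral_cons//.
pose v' : 'cV[R]_n := \col_i v (lift ord0 i) 0.
pose g (a : R) (p : measurableTypeR R * Rn R n) := f (Rn_cons (p.1 + a, p.2)).
have mg a : measurable_fun setT (g a).
  apply: measurableT_comp => //; apply: (measurableT_comp (@measurable_Rn_cons R n)).
  apply/measurable_fun_pairP; split=> //=.
    by apply: measurable_funD => //; exact: measurable_fst.
  exact: measurable_snd.
have g0 a p : (0 <= g a p)%E by exact: f0.
(* the last coordinates are translated by induction, the first one by
   periodicity in one variable, after exchanging the order of integration *)
transitivity (\int[(uniform_prob (two_pi_gt0 R) \x torus_measure R n)%E]_p
    g (v 0%R 0%R) p)%E.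
  rewrite fubini_tonelli1//; last first.
    exact: (measurableT_comp (mft v) (@measurable_Rn_cons R n)).
  rewrite [RHS]fubini_tonelli1//; apply: eq_integral => x _; rewrite /fubini_F.
  under eq_integral do rewrite translate_cons/= -/v'.
  rewrite (IH (fun y => f (Rn_cons (x + v 0 0, y))))//.
    exact: (measurableT_comp (mg (v 0 0)) (measurable_pair1 x)).
  move=> y k.
  pose k' : Zn n.+1 := [ffun i => if unlift ord0 i is Some j then k j else 0].
  rewrite -[RHS](fp _ k') translate_cons /=; congr (f (Rn_cons (_, _))).
    by rewrite mxE ffunE unlift_none mulr0 addr0.
  congr Rn_translate; apply/matrixP => i j.
  by rewrite !mxE ffunE liftK.
rewrite fubini_tonelli2// [RHS]fubini_tonelli2//.
apply: eq_integral => y _; rewrite /fubini_G /g/=.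
have my a : measurable_fun setT
    ((fun x => f (Rn_cons (x + a, y))) : measurableTypeR R -> \bar R).
  exact: (measurableT_comp (mg a) (measurable_pair2 y)).
have m0 : measurable_fun setT
    ((fun x => f (Rn_cons (x, y))) : measurableTypeR R -> \bar R).
  exact: (measurableT_comp mc (measurable_pair2 y)).
rewrite !integral_uniform//; congr (_ * _)%E.
apply: (integral_period_translate (f := fun x => f (Rn_cons (x, y)))) => //.
  exact: two_pi_gt0.
move=> x k.
pose k' : Zn n.+1 := [ffun i => if i == ord0 then k else 0].
rewrite -[RHS](fp _ k') translate_cons/=; congr (f (Rn_cons (_, _))).
  by rewrite mxE ffunE eqxx.
rewrite -[LHS]translate0; congr Rn_translate; apply/matrixP => i j.
by rewrite !mxE ffunE mulr0.
Qed.

(** * The L2 seminorm on the torus *)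

Section L2Norm.
Context (R : realType) (n : nat).
Implicit Types f g : Rn R n -> R[i].

Lemma normc_sqrtE (z : R[i]) :
  normc z = Num.sqrt (complex.Re z ^+ 2 + complex.Im z ^+ 2).
Proof. by case: z. Qed.

Lemma normc_ge0 (z : R[i]) : 0 <= normc z.
Proof. by rewrite normc_sqrtE sqrtr_ge0. Qed.

Lemma normc_expi (t : R) : normc (expi t) = 1.
Proof. by rewrite /normc /expi cos2Dsin2 sqrtr1. Qed.

Lemma normc_real (a : R) : 0 <= a -> normc a%:C%C = a.
Proof. by move=> a0; rewrite /normc /= expr0n/= addr0 sqrtr_sqr ger0_norm. Qed.

Definition cmeasurable f :=
  measurable_fun setT (fun x => complex.Re (f x) : measurableTypeR R) /\
  measurable_fun setT (fun x => complex.Im (f x) : measurableTypeR R).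

Lemma cmeasurableD f g :
  cmeasurable f -> cmeasurable g -> cmeasurable (fun x => f x + g x).
Proof.
move=> [f1 f2] [g1 g2]; split.
  rewrite (_ : (fun x => _) = fun x => complex.Re (f x) + complex.Re (g x)).
    exact: measurable_funD.
  by apply/funext => x; case: (f x) (g x) => ? ? [].
rewrite (_ : (fun x => _) = fun x => complex.Im (f x) + complex.Im (g x)).
  exact: measurable_funD.
by apply/funext => x; case: (f x) (g x) => ? ? [].
Qed.

Lemma cmeasurableM f g :
  cmeasurable f -> cmeasurable g -> cmeasurable (fun x => f x * g x).
Proof.
move=> [f1 f2] [g1 g2]; split.
  rewrite (_ : (fun x => _) = fun x => complex.Re (f x) * complex.Re (g x)
                                       - complex.Im (f x) * complex.Im (g x)).
    by apply: measurable_funB; exact: measurable_funM.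
  by apply/funext => x; case: (f x) (g x) => ? ? [].
rewrite (_ : (fun x => _) = fun x => complex.Re (f x) * complex.Im (g x)
                                     + complex.Im (f x) * complex.Re (g x)).
  by apply: measurable_funD; exact: measurable_funM.
by apply/funext => x; case: (f x) (g x) => ? ? [].
Qed.

Lemma cmeasurable_cst (c : R[i]) : cmeasurable (fun=> c).
Proof. by split; exact: measurable_cst. Qed.

Lemma cmeasurable_sum I (s : seq I) (F : I -> Rn R n -> R[i]) :
  (forall i, cmeasurable (F i)) -> cmeasurable (fun x => \sum_(i <- s) F i x).
Proof.
move=> mF; elim: s => [|i s IH].
  by under eq_fun do rewrite big_nil; exact: cmeasurable_cst.
by under eq_fun do rewrite big_cons; exact: cmeasurableD.
Qed.

Lemma cmeasurable_translate f (v : 'cV[R]_n) :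
  cmeasurable f -> cmeasurable (fun x => f (Rn_translate x v)).
Proof.
by move=> [f1 f2]; split;
  [exact: (measurableT_comp f1 (measurable_translate v))
  |exact: (measurableT_comp f2 (measurable_translate v))].
Qed.

Lemma measurable_normc f :
  cmeasurable f -> measurable_fun setT (fun x => normc (f x) : measurableTypeR R).
Proof.
move=> [f1 f2]; under eq_fun do rewrite normc_sqrtE.
have msqrt : measurable_fun setT
    (Num.sqrt : measurableTypeR R -> measurableTypeR R).
  exact: (continuous_measurable_fun (@sqrt_continuous R)).
apply: (measurableT_comp msqrt).
by apply: measurable_funD; exact: measurable_funX.
Qed.

Definition char (k : Zn n) (x : Rn R n) : R[i] :=
  expi (\sum_j (k j)%:~R * tnth x j).

Lemma cmeasurable_expi (f : Rn R n -> R) :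
  measurable_fun setT (f : Rn R n -> measurableTypeR R) ->
  cmeasurable (fun x => expi (f x)).
Proof.
have mcos : measurable_fun setT (cos : measurableTypeR R -> measurableTypeR R).
  exact: (continuous_measurable_fun (@continuous_cos R)).
have msin : measurable_fun setT (sin : measurableTypeR R -> measurableTypeR R).
  exact: (continuous_measurable_fun (@continuous_sin R)).
by move=> mf; split;
  [exact: (measurableT_comp mcos mf)|exact: (measurableT_comp msin mf)].
Qed.

Lemma measurable_linear_form (k : Zn n) (c : R) :
  measurable_fun setT ((fun x : Rn R n => \sum_j (k j)%:~R * tnth x j - c)
    : Rn R n -> measurableTypeR R).
Proof.
apply: measurable_funB => //; apply: measurable_sum => j.
by apply: measurable_funM => //; exact: measurable_tnth.
Qed.

Lemma cmeasurable_char k : cmeasurable (char k).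
Proof.
apply: cmeasurable_expi; have := measurable_linear_form k 0.
by under eq_fun do rewrite subr0.
Qed.

Lemma Lnorm2E (h : Rn R n -> R) : (forall x, 0 <= h x) ->
  Lnorm (torus_measure R n) 2%:E (EFin \o h) =
  ((\int[torus_measure R n]_x (h x ^+ 2)%:E) `^ 2^-1)%E.
Proof.
move=> h0; rewrite unlock; congr (_ `^ _)%E; apply: eq_integral => x _ /=.
by rewrite ger0_norm// powR_mulrn.
Qed.

Lemma L2normE f :
  L2norm f = ((\int[torus_measure R n]_x ((normc (f x)) ^+ 2)%:E) `^ 2^-1)%E.
Proof. by apply: Lnorm2E => x; exact: normc_ge0. Qed.

Lemma L2norm_ge0 f : (0 <= L2norm f)%E.
Proof. exact: Lnorm_ge0. Qed.

Lemma measurable_normc2 f : cmeasurable f ->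
  measurable_fun setT (fun x => ((normc (f x)) ^+ 2)%:E).
Proof.
by move=> mf; apply/measurable_EFinP; apply: measurable_funX; exact: measurable_normc.
Qed.

Lemma L2normD f g : cmeasurable f -> cmeasurable g ->
  (L2norm (fun x => f x + g x)%R <= L2norm f + L2norm g)%E.
Proof.
move=> mf mg.
apply: (@le_trans _ _ (Lnorm (torus_measure R n) 2%:E
   (EFin \o ((fun x => normc (f x)) \+ (fun x => normc (g x)))%R))).
  have h0 x : 0 <= normc (f x) + normc (g x) by rewrite addr_ge0 ?normc_ge0.
  have mh : measurable_fun setT
      (fun x => normc (f x) + normc (g x) : measurableTypeR R).
    by apply: measurable_funD; exact: measurable_normc.
  rewrite L2normE Lnorm2E//; apply: gt0_ler_poweR; rewrite ?invr_ge0//.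
  - by rewrite in_itv/= leey andbT; apply: integral_ge0 => x _; rewrite lee_fin sqr_ge0.
  - by rewrite in_itv/= leey andbT; apply: integral_ge0 => x _; rewrite lee_fin sqr_ge0.
  apply: ge0_le_integral => //.
  - by move=> x _; rewrite lee_fin sqr_ge0.
  - exact: (measurable_normc2 (cmeasurableD mf mg)).
  - by apply/measurable_EFinP; exact: measurable_funX.
  - move=> x _ /=; rewrite lee_fin lerXn2r ?nnegrE ?normc_ge0//.
    exact: le_normcD.
by apply: eminkowski; [exact: measurable_normc..|rewrite lee_fin ler1n].
Qed.

Lemma L2normZ (c : R[i]) f : cmeasurable f ->
  L2norm (fun x => c * f x)%R = ((normc c)%:E * L2norm f)%E.
Proof.
move=> mf; rewrite !L2normE.
under eq_integral do rewrite normcM exprMn EFinM.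
rewrite ge0_integralZl//; last 3 first.
- exact: measurable_normc2.
- by move=> x _; rewrite lee_fin sqr_ge0.
- by rewrite lee_fin sqr_ge0.
rewrite poweRM ?lee_fin ?sqr_ge0//; last first.
  by apply: integral_ge0 => x _; rewrite lee_fin sqr_ge0.
congr (_ * _)%E; rewrite poweR_EFin -powR_mulrn ?normc_ge0// -powRrM.
by rewrite mulfV// powRr1// normc_ge0.
Qed.

Lemma L2norm_cst (c : R[i]) : L2norm ((fun=> c) : Rn R n -> R[i]) = (normc c)%:E.
Proof.
rewrite L2normE integral_cst//= probability_setT mule1.
by rewrite poweR_EFin -powR_mulrn ?normc_ge0// -powRrM mulfV// powRr1// normc_ge0.
Qed.

Lemma eq_L2norm f g : (forall x, normc (f x) = normc (g x)) ->
  L2norm f = L2norm g.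
Proof. by move=> fg; rewrite !L2normE; under eq_integral do rewrite fg. Qed.

Lemma L2norm_translate f (v : 'cV[R]_n) : cmeasurable f -> Defs.periodic f ->
  L2norm (fun x => f (Rn_translate x v)) = L2norm f.
Proof.
move=> mf pf; rewrite !L2normE; congr (_ `^ _)%E.
apply: (torus_integral_translate (f := fun x => ((normc (f x)) ^+ 2)%:E)).
- exact: measurable_normc2.
- by move=> x; rewrite lee_fin sqr_ge0.
- by move=> x k; rewrite pf.
Qed.

End L2Norm.

(** * The norms of finite sums of monomials *)

Section Characters.
Context (R : realType) (n : nat).
Implicit Types (k l : Zn n) (v : 'cV[R]_n).

Lemma expi0 : expi (0 : R) = 1.
Proof. by rewrite /expi cos0 sin0. Qed.

Lemma expi_pi : expi (pi : R) = -1.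
Proof. by rewrite /expi cospi sinpi; apply/eqP; rewrite eq_complex /= oppr0 !eqxx. Qed.

Lemma expi_2pi (m : int) : expi (2 * pi * m%:~R : R) = 1.
Proof.
have e1 : expi (2 * pi : R) = 1 by rewrite mulr_natl mulr2n expiD expi_pi mulN1r opprK.
have en (p : nat) : expi (2 * pi * p%:R : R) = 1.
  elim: p => [|p IH]; first by rewrite mulr0 expi0.
  by rewrite -(natr1 p) mulrDr mulr1 expiD IH e1 mulr1.
case: m => p; first by rewrite -pmulrn en.
have := en p.+1; rewrite NegzE mulrNz -pmulrn => h.
by rewrite -[LHS]mulr1 -h -expiD mulrN addNr expi0.
Qed.

Lemma char_translate k v (x : Rn R n) :
  char k (Rn_translate x v) = expi (\sum_j (k j)%:~R * v j 0) * char k x.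
Proof.
rewrite /char -expiD -big_split; congr expi; apply: eq_bigr => j _ /=.
by rewrite tnth_translate mulrDr addrC.
Qed.

Lemma char_periodic k : Defs.periodic (@char R n k).
Proof.
move=> x m; rewrite char_translate -[RHS]mul1r; congr (_ * _).
have -> : \sum_j (k j)%:~R * (\col_i (2 * pi * (m i)%:~R)) j 0 =
    2 * pi * (\sum_j k j * m j)%:~R :> R.
  rewrite (rmorph_sum (intmul 1)) mulr_sumr; apply: eq_bigr => j _.
  by rewrite mxE rmorphM/= mulrCA.
exact: expi_2pi.
Qed.

(** Induction on the number of other frequencies: for [l] distinct from [k] some
    translation changes the sign of [char l] relatively to [char k], so the
    average of a function and of its suitably rotated translate keeps the
    coefficient at [k], loses the one at [l], and has no larger norm. *)
Lemma coef_le_L2norm k (s : seq (Zn n)) (a : R[i]) (c : Zn n -> R[i]) :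
  k \notin s ->
  ((normc a)%:E <=
   L2norm (fun x : Rn R n => a * char k x + \sum_(l <- s) c l * char l x)%R)%E.
Proof.
elim: s c => [|l s IH] c.
  move=> _; rewrite (@eq_L2norm _ _ _ (fun=> a)) ?L2norm_cst// => x.
  by rewrite big_nil addr0 normcM normc_expi mulr1.
rewrite inE negb_or => /andP[kl ks].
have [j ljk] : exists j, l j != k j.
  apply/existsP; rewrite -negb_forall; apply: contra kl => /forallP h.
  by apply/eqP/ffunP => j; apply/esym/eqP/h.
pose d : R := (l j - k j)%:~R.
have d0 : d != 0 by rewrite intr_eq0 subr_eq0.
pose v : 'cV[R]_n := \col_i (if i == j then pi / d else 0).
pose F x := a * char k x + \sum_(l <- l :: s) c l * char l x : R[i].
have dot (m : Zn n) : \sum_i (m i)%:~R * v i 0 = (m j)%:~R * (pi / d).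
  rewrite (bigD1 j)//= mxE eqxx big1 ?addr0// => i ij.
  by rewrite mxE (negbTE ij) mulr0.
pose w (m : Zn n) := expi (((m j)%:~R - (k j)%:~R) * (pi / d)) : R[i].
have mM (b : R[i]) (g : Rn R n -> R[i]) :
    cmeasurable g -> cmeasurable (fun x => b * g x).
  by move=> mg; exact: (cmeasurableM (cmeasurable_cst n b) mg).
have mF : cmeasurable F.
  rewrite /F; apply: cmeasurableD; first exact: (mM _ _ (cmeasurable_char R k)).
  by apply: cmeasurable_sum => i; exact: (mM _ _ (cmeasurable_char R i)).
have pF : Defs.periodic F.
  by move=> x m; rewrite /F char_periodic; congr (_ + _); apply: eq_bigr => i _;
    rewrite char_periodic.
pose G x := 2^-1 * (F x + expi (- ((k j)%:~R * (pi / d))) * F (Rn_translate x v)) : R[i].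
have GE x : G x = a * char k x + \sum_(i <- s) (2^-1 * (1 + w i) * c i) * char i x.
  have wE m : expi (- ((k j)%:~R * (pi / d))) * char m (Rn_translate x v) =
      w m * char m x :> R[i].
    by rewrite char_translate dot mulrA -expiD /w; congr (expi _ * _); ring.
  have wk : w k = 1 by rewrite /w subrr mul0r expi0.
  have wl : w l = -1 by rewrite /w -intrB mulrCA mulfV// mulr1 expi_pi.
  have -> : G x = 2^-1 * (1 + w k) * a * char k x +
      \sum_(i <- l :: s) (2^-1 * (1 + w i) * c i) * char i x.
    have eF : expi (- ((k j)%:~R * (pi / d))) * F (Rn_translate x v) =
        w k * a * char k x + \sum_(i <- l :: s) w i * c i * char i x.
      rewrite /F mulrDr mulr_sumr; congr (_ + _).
        by rewrite mulrCA wE; ring.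
      by apply: eq_bigr => i _; rewrite mulrCA wE; ring.
    rewrite /G eF /F addrACA mulrDr -big_split mulr_sumr; congr (_ + _).
      by ring.
    by apply: eq_bigr => i _ /=; ring.
  rewrite big_cons wk wl subrr mulr0 !mul0r add0r; congr (_ * _ + _).
  by rewrite -[1 + 1]/2%:R mulVf ?mul1r// pnatr_eq0.
have mFv := cmeasurable_translate v mF.
apply: (@le_trans _ _ (L2norm G)).
  by rewrite (@eq_L2norm _ _ G _ (fun x => congr1 (@normc R) (GE x))); exact: IH.
rewrite L2normZ; last first.
  exact: (cmeasurableD mF (mM _ _ mFv)).
apply: (@le_trans _ _ ((normc (2^-1 : R[i]))%:E * (L2norm F + L2norm F))%E).
  apply: lee_wpmul2l; first by rewrite lee_fin normc_ge0.
  apply: (le_trans (L2normD mF (mM _ _ mFv))).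
  by rewrite L2normZ// normc_expi mul1e L2norm_translate.
have -> : normc (2^-1 : R[i]) = 2^-1.
  by rewrite normcV (_ : 2 = 2%:C%C) ?normc_real// rmorph_nat.
have := L2norm_ge0 F; case: (L2norm F) => [r||]//= _.
  by rewrite -EFinD -EFinM lee_fin; lra.
by rewrite addye// gt0_muley// lte_fin invr_gt0.
Qed.
End Characters.

Section OperatorNorm.
Context (R : realType) (n : nat) (theta : 'M[R]_n).
Hypothesis theta_asym : theta^T = - theta.
Implicit Types (k : Zn n) (s : seq (Zn n)) (u : Zn n -> R[i]) (xi : Rn R n -> R[i]).

Definition monomial_sum s u xi (x : Rn R n) : R[i] :=
  \sum_(k <- s) u k * Umon theta k xi x.

Lemma cmeasurable_Umon k xi : cmeasurable xi -> cmeasurable (Umon theta k xi).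
Proof.
move=> mxi; rewrite (_ : Umon theta k xi = fun x => Umon theta k xi x)//.
under eq_fun do rewrite UmonE//.
apply: cmeasurableM; last exact: (cmeasurable_translate _ mxi).
exact: (cmeasurable_expi (measurable_linear_form _ _)).
Qed.

Lemma L2norm_Umon k xi : cmeasurable xi -> Defs.periodic xi ->
  L2norm (Umon theta k xi) = L2norm xi.
Proof.
move=> mxi pxi; rewrite -[RHS](L2norm_translate
  (\sum_j ((k j)%:~R * pi) *: col j theta) mxi pxi).
by apply: eq_L2norm => x; rewrite UmonE// normcM normc_expi mul1r.
Qed.

Lemma cmeasurable_monomial_sum s u xi :
  cmeasurable xi -> cmeasurable (monomial_sum s u xi).
Proof.
move=> mxi; apply: cmeasurable_sum => k.
exact: (cmeasurableM (cmeasurable_cst n (u k)) (cmeasurable_Umon k mxi)).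
Qed.

Lemma L2norm_monomial_sum s u xi : cmeasurable xi -> Defs.periodic xi ->
  (L2norm (monomial_sum s u xi) <= (\sum_(k <- s) normc (u k))%:E * L2norm xi)%E.
Proof.
move=> mxi pxi; elim: s => [|k s IH].
  rewrite big_nil mul0e (@eq_L2norm _ _ _ (fun=> 0)); last first.
    by move=> x; rewrite /monomial_sum big_nil.
  by rewrite L2norm_cst normc0.
have := L2normD (cmeasurableM (cmeasurable_cst n (u k)) (cmeasurable_Umon k mxi))
  (cmeasurable_monomial_sum s u mxi).
rewrite (@eq_L2norm _ _ _ (monomial_sum (k :: s) u xi)); last first.
  by move=> x; rewrite /monomial_sum big_cons.
move/le_trans; apply; rewrite big_cons EFinD ge0_muleDl ?lee_fin ?normc_ge0//; last first.
  by apply: sumr_ge0 => l _; exact: normc_ge0.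
by rewrite leeD// L2normZ ?L2norm_Umon//; exact: cmeasurable_Umon.
Qed.

Lemma L2_cst (c : R[i]) : L2 ((fun=> c) : Rn R n -> R[i]).
Proof.
have [? ?] := cmeasurable_cst n c.
by split=> //; rewrite L2norm_cst ltry.
Qed.

Definition opnorm_set s u : set R :=
  [set fine (L2norm (monomial_sum s u xi)) | xi in
    [set xi | L2 xi /\ (L2norm xi <= 1)%E]].

Lemma L2norm_monomial_sum_unit s u xi : L2 xi -> (L2norm xi <= 1)%E ->
  (L2norm (monomial_sum s u xi) <= (\sum_(k <- s) normc (u k))%:E)%E.
Proof.
move=> [pxi m1 m2 _] x1.
apply: (le_trans (L2norm_monomial_sum s u (conj m1 m2) pxi)).
rewrite -[leRHS]mule1; apply: lee_wpmul2l => //; rewrite lee_fin.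
by apply: sumr_ge0 => l _; exact: normc_ge0.
Qed.

Lemma fin_L2norm_monomial_sum s u xi : L2 xi -> (L2norm xi <= 1)%E ->
  (L2norm (monomial_sum s u xi) \is a fin_num).
Proof.
move=> Lxi x1; rewrite ge0_fin_numE ?L2norm_ge0//.
exact: le_lt_trans (L2norm_monomial_sum_unit s u Lxi x1) (ltry _).
Qed.

Lemma opnorm_set_ub s u : ubound (opnorm_set s u) (\sum_(k <- s) normc (u k)).
Proof.
move=> _ [xi [Lxi x1] <-]; rewrite -lee_fin fineK ?fin_L2norm_monomial_sum//.
exact: L2norm_monomial_sum_unit.
Qed.

Lemma opnorm_set_has_sup s u : has_sup (opnorm_set s u).
Proof.
split; last by exists (\sum_(k <- s) normc (u k)); exact: opnorm_set_ub.
exists (fine (L2norm (monomial_sum s u (fun=> 0)))), (fun=> 0) => //; split.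
  exact: L2_cst.
by rewrite L2norm_cst normc0 lee_fin.
Qed.

Lemma opnorm_monomial_sum_le s u :
  opnorm (monomial_sum s u) <= \sum_(k <- s) normc (u k).
Proof.
by apply: ge_sup; [case: (opnorm_set_has_sup s u)|exact: opnorm_set_ub].
Qed.

Lemma opnorm_monomial_sum_ge s u xi : L2 xi -> (L2norm xi <= 1)%E ->
  fine (L2norm (monomial_sum s u xi)) <= opnorm (monomial_sum s u).
Proof.
move=> Lxi x1; apply: (ub_le_sup (proj2 (opnorm_set_has_sup s u))).
by exists xi.
Qed.

Lemma opnorm_monomial_sum_ge0 s u : 0 <= opnorm (monomial_sum s u).
Proof.
apply: le_trans (opnorm_monomial_sum_ge s u (L2_cst 0) _).
  by rewrite fine_ge0// L2norm_ge0.
by rewrite L2norm_cst normc0 lee_fin.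
Qed.

Lemma opnorm_monomial_sum_cat s s' u :
  opnorm (monomial_sum (s ++ s') u) <=
  opnorm (monomial_sum s u) + \sum_(k <- s') normc (u k).
Proof.
apply: ge_sup; first by case: (opnorm_set_has_sup (s ++ s') u).
move=> _ [xi [Lxi x1] <-].
apply: (@le_trans _ _ (fine (L2norm (monomial_sum s u xi)) +
  \sum_(k <- s') normc (u k))); last by rewrite lerD2r opnorm_monomial_sum_ge.
rewrite -lee_fin EFinD !fineK ?fin_L2norm_monomial_sum//.
rewrite (@eq_L2norm _ _ _ (fun x => monomial_sum s u xi x + monomial_sum s' u xi x)); last first.
  by move=> x; rewrite /monomial_sum big_cat.
have [pxi m1 m2 _] := Lxi.
apply: (le_trans (L2normD (cmeasurable_monomial_sum s u (conj m1 m2))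
  (cmeasurable_monomial_sum s' u (conj m1 m2)))).
by rewrite leeD2l// L2norm_monomial_sum_unit.
Qed.

(** Applied to the constant function one, the operator yields a trigonometric
    polynomial whose coefficients have the moduli of those of [u]. *)
Lemma coef_le_opnorm s u k : uniq s -> k \in s ->
  normc (u k) <= opnorm (monomial_sum s u).
Proof.
move=> us ks.
have n1 : L2norm ((fun=> 1 : R[i]) : Rn R n -> R[i]) = 1%E.
  by rewrite L2norm_cst normc1.
apply: le_trans (opnorm_monomial_sum_ge s u (L2_cst 1) _); last by rewrite n1.
rewrite -lee_fin fineK; last by apply: fin_L2norm_monomial_sum; [exact: L2_cst|rewrite n1].
pose c l : R[i] := u l * expi (- (pi * \sum_(a < n) \sum_(b < n | (a < b)%N)
  theta a b * (l a)%:~R * (l b)%:~R)).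
have -> : normc (u k) = normc (c k) by rewrite normcM normc_expi mulr1.
have nk : k \notin rem k s by rewrite mem_rem_uniq// !inE eqxx.
apply: le_trans (coef_le_L2norm (c k) c nk) _; rewrite le_eqVlt; apply/orP; left.
apply/eqP/eq_L2norm => x; congr normc.
rewrite /monomial_sum (perm_big _ (perm_to_rem ks)) big_cons.
have E l : u l * Umon theta l (fun=> 1) x = c l * char l x.
  by rewrite UmonE// mulr1 expiD /c -mulrA; congr (_ * _); rewrite mulrC.
by rewrite E; congr (_ + _); apply: eq_bigr => l _; rewrite E.
Qed.

End OperatorNorm.

(** * Summation over the lattice *)

Section Boxes.
Context (n : nat).
Implicit Types (k l : Zn n) (N M : nat).

Definition box_shift N (g : {ffun 'I_n -> 'I_(N.*2.+1)}) : Zn n :=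
  [ffun j => (g j)%:Z - N%:Z].

Definition box_seq N : seq (Zn n) := [seq box_shift g | g : {ffun 'I_n -> 'I_(N.*2.+1)}].

Lemma box_shift_inj N : injective (@box_shift N).
Proof.
move=> g h /ffunP gh; apply/ffunP => j; apply/val_inj => /=.
by have := gh j; rewrite !ffunE => /addIr [].
Qed.

Lemma box_seq_uniq N : uniq (box_seq N).
Proof. by rewrite map_inj_uniq ?enum_uniq//; exact: box_shift_inj. Qed.

Lemma mem_box_seq N k : (k \in box_seq N) = [forall j, (`|k j| <= N)%N].
Proof.
apply/mapP/forallP => [[g _ ->] j|h].
  by rewrite ffunE; case: (g j) => i /=; rewrite -addnn; lia.
have b j : (`|(k j + N%:Z)%R| < N.*2.+1)%N by rewrite -addnn; have := h j; lia.
exists [ffun j => Ordinal (b j)]; first by rewrite mem_enum.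
by apply/ffunP => j; rewrite !ffunE /=; have := h j; lia.
Qed.

Lemma box_seqE N : @box n N = [set` box_seq N].
Proof. by apply/seteqP; split => k /=; rewrite mem_box_seq => /forallP. Qed.

Lemma fsbig_box (V : nmodType) N (f : Zn n -> V) :
  \sum_(k \in @box n N) f k = \sum_(k <- box_seq N) f k.
Proof. by rewrite box_seqE -fsbig_seq// box_seq_uniq. Qed.

Lemma perm_box_seq N M : (N <= M)%N ->
  perm_eq (box_seq M) (box_seq N ++ [seq k <- box_seq M | k \notin box_seq N]).
Proof.
move=> NM; apply: uniq_perm; first exact: box_seq_uniq.
  rewrite cat_uniq box_seq_uniq filter_uniq ?box_seq_uniq// andbT.
  by apply/hasPn => k; rewrite mem_filter => /andP[].
move=> k; rewrite mem_cat mem_filter; case: (boolP (k \in box_seq N)) => //= kN.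
rewrite mem_box_seq; apply/forallP => j; move: kN; rewrite mem_box_seq.
by move=> /forallP/(_ j)/leq_trans; apply.
Qed.

Lemma mem_box_seq_norm N k : (\sum_j `|k j| <= N)%N -> k \in box_seq N.
Proof.
move=> kN; rewrite mem_box_seq; apply/forallP => j; apply: leq_trans kN.
by rewrite (bigD1 j)//= leq_addr.
Qed.

End Boxes.

Section Weights.
Context (R : realType) (n : nat).
Implicit Types (k l : Zn n) (N M : nat).

Definition weight k : R := 1 + \sum_(j < n) `|k j|%N%:R.

Lemma weight_ge1 k : 1 <= weight k.
Proof. by rewrite lerDl sumr_ge0// => j _; rewrite ler0n. Qed.

Lemma weight_gt0 k : 0 < weight k.
Proof. exact: lt_le_trans (weight_ge1 k). Qed.

Lemma weight_ge0 k : 0 <= weight k.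
Proof. exact: ltW (weight_gt0 k). Qed.

Lemma weightN k : weight (- k) = weight k.
Proof. by congr (1 + _); apply: eq_bigr => j _; rewrite ffunE abszN. Qed.

Lemma coord_le_weight k j : `|k j|%N%:R <= weight k.
Proof.
by rewrite /weight (bigD1 j)//= addrCA lerDl addr_ge0// sumr_ge0.
Qed.

Lemma box_sum_subset (g : Zn n -> R) N M : (forall k, 0 <= g k) -> (N <= M)%N ->
  \sum_(k <- box_seq n N) g k <= \sum_(k <- box_seq n M) g k.
Proof.
move=> g0 NM; rewrite [leRHS](perm_big _ (perm_box_seq n NM))/= big_cat/= lerDl.
exact: sumr_ge0.
Qed.

(** The bound telescopes: enlarging the interval adds two terms
    [1 / (N + 2)^2], each at most [1 / (N + 1) - 1 / (N + 2)]. *)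
Lemma sum_inv_square N :
  \sum_(i < N.*2.+1) ((1 + `|i%:Z - N%:Z|%N%:R) ^+ 2)^-1 <= 4 - 2 / N.+1%:R :> R.
Proof.
elim: N => [|N IH].
  by rewrite double0 big_ord1 subrr absz0 addr0 expr1n invr1; lra.
rewrite doubleS big_ord_recl big_ord_recr /=.
have -> : \sum_(i < N.*2.+1) ((1 + `|(bump 0 i)%:Z - N.+1%:Z|%N%:R) ^+ 2)^-1 =
  \sum_(i < N.*2.+1) ((1 + `|i%:Z - N%:Z|%N%:R) ^+ 2)^-1 :> R.
  by apply: eq_bigr => i _; do 4 f_equal; rewrite /bump; lia.
rewrite subn0.
have -> : `|(bump 0 N.*2.+1)%:Z - N.+1%:Z|%N = N.+1 by rewrite /bump; lia.
set x : R := N.+1%:R; have x0 : 0 < x by rewrite ltr0n.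
have -> : N.+2%:R = 1 + x by rewrite addrC natr1.
suff h : ((1 + x) ^+ 2)^-1 + ((1 + x) ^+ 2)^-1 <= 2 / x - 2 / (1 + x).
  move: IH h; rewrite -/x; move: (2 / x) (2 / (1 + x)) (((1 + x) ^+ 2)^-1).
  by move=> a b c; set S := \sum_(i < _) _; lra.
have -> : 2 / x - 2 / (1 + x) = 2 / (x * (1 + x)) by field; lra.
have : ((1 + x) ^+ 2)^-1 <= (x * (1 + x))^-1.
  by rewrite lef_pV2 ?posrE ?exprn_gt0 ?mulr_gt0//; nra.
by move: ((1 + x) ^+ 2)^-1 (x * (1 + x))^-1 => a b; lra.
Qed.

(** The weight to the power [2 n] is summable because the summand is at most
    the product of the [(1 + |k_j|)^(-2)], whose sum over a cube factors. *)
Lemma sum_inv_weight N :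
  \sum_(k <- box_seq n N) (weight k ^+ (2 * n))^-1 <= 4 ^+ n.
Proof.
rewrite /box_seq big_image /=.
pose h (i : 'I_(N.*2.+1)) : R := ((1 + `|i%:Z - N%:Z|%N%:R) ^+ 2)^-1.
have h0 i : 0 <= h i by rewrite invr_ge0 exprn_ge0// addr_ge0.
apply: (@le_trans _ _ (\sum_(g : {ffun 'I_n -> 'I_(N.*2.+1)}) \prod_j h (g j))).
  apply: ler_sum => g _; rewrite prodfV lef_pV2 ?posrE.
  - have -> : weight (box_shift g) ^+ (2 * n) =
        \prod_(j < n) weight (box_shift g) ^+ 2.
      by rewrite prodr_const card_ord exprM.
    apply: ler_prod => j _.
    rewrite exprn_ge0 ?addr_ge0//= lerXn2r ?nnegrE ?weight_ge0 ?addr_ge0//.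
    by rewrite /weight lerD2l (bigD1 j)//= ffunE lerDl sumr_ge0.
  - by rewrite exprn_gt0// weight_gt0.
  - by apply: prodr_gt0 => j _; rewrite exprn_gt0// ltr_pwDl.
have -> : \sum_(g : {ffun 'I_n -> 'I_(N.*2.+1)}) \prod_j h (g j) =
    \prod_(j < n) \sum_i h i by rewrite bigA_distr_bigA.
rewrite prodr_const card_ord lerXn2r ?nnegrE ?sumr_ge0//.
by apply: le_trans (sum_inv_square N) _; rewrite lerBlDr lerDl divr_ge0.
Qed.

End Weights.

Section SumZ.
Context (R : realType) (n : nat).
Implicit Types (f g : Zn n -> R[i]) (h : Zn n -> R) (N : nat).

Lemma cvg_box_ge0 h M : (forall k, 0 <= h k) ->
  (forall N, \sum_(k <- box_seq n N) h k <= M) ->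
  cvgn (fun N => \sum_(k <- box_seq n N) h k).
Proof.
move=> h0 hM; apply: nondecreasing_is_cvgn.
  by move=> N N' NN'; exact: box_sum_subset.
by exists M => _ [N _ <-].
Qed.

(** Write [h] as [h' - (h' - h)], a difference of nonnegative families. *)
Lemma cvg_box_dominated h h' M : (forall k, `|h k| <= h' k) ->
  (forall N, \sum_(k <- box_seq n N) h' k <= M) ->
  cvgn (fun N => \sum_(k <- box_seq n N) h k).
Proof.
move=> hh' hM.
have c' : cvgn (fun N => \sum_(k <- box_seq n N) h' k).
  by apply: cvg_box_ge0 hM => k; exact: le_trans (hh' k).
have c : cvgn (fun N => \sum_(k <- box_seq n N) (h' k - h k)).
  apply: (@cvg_box_ge0 _ (M + M)) => [k|N].
    by rewrite subr_ge0 (le_trans (ler_norm _)).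
  rewrite big_split/=; apply: lerD => //; apply: le_trans (hM N).
  by apply: ler_sum => k _; rewrite (le_trans _ (hh' k))// -normrN ler_norm.
rewrite (_ : (fun N => _) = (fun N => \sum_(k <- box_seq n N) h' k) -
    (fun N => \sum_(k <- box_seq n N) (h' k - h k))); last first.
  by apply/funext => N /=; rewrite !fctE -sumrB; apply: eq_bigr => k _; rewrite subKr.
exact: is_cvgB.
Qed.

Lemma normc_le_ReIm (z : R[i]) :
  normc z <= `|complex.Re z| + `|complex.Im z|.
Proof.
rewrite normc_sqrtE -[leRHS](ger0_norm (addr_ge0 (normr_ge0 _) (normr_ge0 _))).
rewrite -sqrtr_sqr ler_sqrt ?sqr_ge0// sqrrD !real_normK ?num_real//.
by rewrite addrAC lerDl mulrn_wge0// mulr_ge0.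
Qed.

Lemma Re_le_normc (z : R[i]) : `|complex.Re z| <= normc z.
Proof. by rewrite normc_sqrtE -sqrtr_sqr ler_wsqrtr// lerDl sqr_ge0. Qed.

Lemma Im_le_normc (z : R[i]) : `|complex.Im z| <= normc z.
Proof. by rewrite normc_sqrtE -sqrtr_sqr ler_wsqrtr// lerDr sqr_ge0. Qed.

Lemma cvg_complexP (T : Type) (F : set_system T) {FF : Filter F}
    (u : T -> R[i]) (l : R[i]) :
  (u : T -> R[i]^o) @ F --> (l : R[i]^o) <->
  forall e : R, 0 < e -> \forall x \near F, normc (l - u x) < e.
Proof.
split.
  move=> /(@cvgrPdist_lt _ (R[i]^o)) ul e e0.
  have := ul e%:C%C; rewrite ltcR => /(_ e0); apply: filterS => x.
  by rewrite -[X in (X < _)%R -> _]/((normc (l - u x))%:C%C) ltcR.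
move=> ul; apply/(@cvgrPdist_lt _ (R[i]^o)) => -[e e']; rewrite ltcE/= => /andP[/eqP-> e0].
have := ul e e0; apply: filterS => x.
by rewrite -[X in _ -> (X < _)%R]/((normc (l - u x))%:C%C) ltcR.
Qed.

Definition summable_family f :=
  exists M, forall N, \sum_(k <- box_seq n N) normc (f k) <= M.

Lemma ReD (x y : R[i]) : complex.Re (x + y) = complex.Re x + complex.Re y.
Proof. by case: x y => ? ? []. Qed.

Lemma ImD (x y : R[i]) : complex.Im (x + y) = complex.Im x + complex.Im y.
Proof. by case: x y => ? ? []. Qed.

Lemma cvg_complex_lim (u : nat -> R[i]) (l : R[i]) :
  (u : nat -> R[i]^o) @ \oo --> (l : R[i]^o) ->
  lim ((u : nat -> R[i]^o) @ \oo) = l.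
Proof. by move=> ul; apply: (@cvg_lim (R[i]^o)) => //; exact: norm_hausdorff. Qed.

Lemma sumZE f :
  sumZ f = lim ((fun N => \sum_(k <- box_seq n N) f k : R[i]^o) @ \oo).
Proof. by rewrite /sumZ; under eq_fun do rewrite fsbig_box. Qed.

Lemma sumZ_cvg f : summable_family f ->
  (fun N => \sum_(k <- box_seq n N) f k : R[i]^o) @ \oo --> (sumZ f : R[i]^o).
Proof.
move=> [M fM].
have cr := cvg_box_dominated (fun k => Re_le_normc (f k)) fM.
have ci := cvg_box_dominated (fun k => Im_le_normc (f k)) fM.
suff h : (fun N => \sum_(k <- box_seq n N) f k : R[i]^o) @ \oo -->
    ((lim ((fun N => \sum_(k <- box_seq n N) complex.Re (f k)) @ \oo) +i*
    lim ((fun N => \sum_(k <- box_seq n N) complex.Im (f k)) @ \oo))%C : R[i]^o).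
  by rewrite sumZE (cvg_complex_lim h).
apply/cvg_complexP => e e0.
have e2 : 0 < e / 2 by rewrite divr_gt0.
move/cvgrPdist_lt : cr => /(_ _ e2) cr; move/cvgrPdist_lt : ci => /(_ _ e2) ci.
near=> N.
have -> : \sum_(k <- box_seq n N) f k =
    ((\sum_(k <- box_seq n N) complex.Re (f k)) +i*
     (\sum_(k <- box_seq n N) complex.Im (f k)))%C.
  apply/eqP; rewrite eq_complex/=; apply/andP; split; apply/eqP.
    exact: (big_morph _ ReD).
  exact: (big_morph _ ImD).
apply: le_lt_trans (normc_le_ReIm _) _.
rewrite (splitr e) ltrD//; near: N; [exact: cr|exact: ci].
Unshelve. all: by end_near. Qed.

Lemma eq_sumZ f g : (forall k, f k = g k) -> sumZ f = sumZ g.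
Proof. by move=> fg; congr sumZ; apply/funext. Qed.

Lemma summable_familyD f g : summable_family f -> summable_family g ->
  summable_family (fun k => f k + g k).
Proof.
move=> [M fM] [L gL]; exists (M + L) => N.
apply: le_trans (lerD (fM N) (gL N)); rewrite -big_split.
by apply: ler_sum => k _; exact: le_normcD.
Qed.

Lemma summable_familyZ c f : summable_family f ->
  summable_family (fun k => c * f k).
Proof.
move=> [M fM]; exists (normc c * M) => N.
under eq_bigr do rewrite normcM.
by rewrite -mulr_sumr ler_wpM2l ?normc_ge0.
Qed.

Lemma sumZD f g : summable_family f -> summable_family g ->
  sumZ (fun k => f k + g k) = sumZ f + sumZ g.
Proof.
move=> sf sg; rewrite [LHS]sumZE; apply: cvg_complex_lim.
under eq_fun do rewrite big_split/=.
exact: (@cvgD _ (R[i]^o) _ _ _ _ _ _ _ (sumZ_cvg sf) (sumZ_cvg sg)).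
Qed.

Lemma sumZZ c f : summable_family f -> sumZ (fun k => c * f k) = c * sumZ f.
Proof.
move=> sf; rewrite [LHS]sumZE; apply: cvg_complex_lim.
under eq_fun do rewrite -mulr_sumr.
exact: (@cvgMl_tmp R[i] _ _ _ _ c _ (sumZ_cvg sf)).
Qed.

Lemma sumZ_single f k : (forall l, l != k -> f l = 0) -> sumZ f = f k.
Proof.
move=> fk; rewrite sumZE; apply: cvg_complex_lim; apply/cvg_complexP => e e0.
near=> N.
have kN : k \in box_seq n N.
  by apply: mem_box_seq_norm; near: N; exact: nbhs_infty_ge.
rewrite (bigD1_seq k)//= ?box_seq_uniq// big1 ?addr0 ?subrr ?normc0//.
Unshelve. all: by end_near. Qed.

Lemma normc_sumZ_le f M :
  (forall N, \sum_(k <- box_seq n N) normc (f k) <= M) -> normc (sumZ f) <= M.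
Proof.
move=> fM; have sf : summable_family f by exists M.
apply/ler_addgt0Pr => e e0; have /cvg_complexP/(_ e e0) cf := sumZ_cvg sf.
near \oo => N.
rewrite -(subrK (\sum_(k <- box_seq n N) f k) (sumZ f)) addrC.
apply: le_trans (le_normcD _ _) _; rewrite lerD//; last first.
  by apply/ltW; near: N; exact: cf.
apply: le_trans (fM N); elim: (box_seq n N) => [|k s IH].
  by rewrite !big_nil normc0.
by rewrite !big_cons; apply: le_trans (le_normcD _ _) _; rewrite lerD2l.
Unshelve. all: by end_near. Qed.

Lemma weight_dominated f M :
  (forall k, normc (f k) <= M * (weight R k ^+ (2 * n))^-1) ->
  forall N, \sum_(k <- box_seq n N) normc (f k) <= M * 4 ^+ n.
Proof.
move=> fM N; apply: (@le_trans _ _ (M * \sum_(k <- box_seq n N) (weight R k ^+ (2 * n))^-1)).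
  by rewrite mulr_sumr; apply: ler_sum => k _; exact: fM.
have M0 : 0 <= M.
  have := le_trans (normc_ge0 (f 0)) (fM 0).
  by rewrite pmulr_lge0// invr_gt0 exprn_gt0// weight_gt0.
by rewrite ler_wpM2l// sum_inv_weight.
Qed.

End SumZ.

(** * The topology of the algebra in terms of coefficients *)

Section CstarNorm.
Context (R : realType) (n : nat) (theta : 'M[R]_n).
Hypothesis theta_asym : theta^T = - theta.
Implicit Types (k : Zn n) (u : Zn n -> R[i]).

Lemma cstar_normE u : cstar_norm theta u =
  lim ((fun N => opnorm (monomial_sum theta (box_seq n N) u)) @ \oo).
Proof.
have E N : (fun xi x => \sum_(k \in @box n N) u k * Umon theta k xi x) =
    monomial_sum theta (box_seq n N) u.
  by apply: funext => xi; apply: funext => x; rewrite fsbig_box.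
by rewrite /cstar_norm; under eq_fun do rewrite E.
Qed.

(** With [s_N] the sum of the moduli of the coefficients in the cube of size
    [N] and [o_N] the norm of the partial sum, [s_N - o_N] is nondecreasing. *)
Lemma cstar_norm_cvg u : summable_family u ->
  cvgn (fun N => opnorm (monomial_sum theta (box_seq n N) u)).
Proof.
move=> [M uM].
pose s N := \sum_(k <- box_seq n N) normc (u k).
pose o N := opnorm (monomial_sum theta (box_seq n N) u).
have cs : cvgn s by exact: (cvg_box_ge0 (fun k => normc_ge0 (u k)) uM).
have co : cvgn (fun N => s N - o N).
  apply: nondecreasing_is_cvgn.
    move=> N N' NN'; rewrite /s /o.
    have -> : monomial_sum theta (box_seq n N') u = monomial_sum theta
        (box_seq n N ++ [seq k <- box_seq n N' | k \notin box_seq n N]) u.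
      apply/funext => xi; apply/funext => x.
      exact: (perm_big _ (perm_box_seq n NN')).
    rewrite (perm_big _ (perm_box_seq n NN'))/= big_cat/= lerBlDr.
    have := opnorm_monomial_sum_cat theta_asym (box_seq n N)
      [seq k <- box_seq n N' | k \notin box_seq n N] u.
    by move=> h; lra.
  exists M => _ [N _ <-]; apply: le_trans (uM N).
  by rewrite gerBl opnorm_monomial_sum_ge0.
rewrite -/o (_ : o = s - (fun N => s N - o N)); last first.
  by apply/funext => N; rewrite !fctE subKr.
exact: is_cvgB.
Qed.

Lemma cstar_norm_le u M :
  (forall N, \sum_(k <- box_seq n N) normc (u k) <= M) -> cstar_norm theta u <= M.
Proof.
move=> uM; rewrite cstar_normE; apply: limr_le.
  by apply: cstar_norm_cvg; exists M.
by apply: nearW => N; exact: le_trans (opnorm_monomial_sum_le theta_asym _ _) (uM N).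
Qed.

Lemma coef_le_cstar_norm u k : summable_family u -> normc (u k) <= cstar_norm theta u.
Proof.
move=> su; rewrite cstar_normE; apply: limr_ge; first exact: cstar_norm_cvg.
exists (\sum_j `|k j|)%N => // N /= kN.
by apply: coef_le_opnorm; rewrite ?box_seq_uniq// mem_box_seq_norm.
Qed.

End CstarNorm.

Section SmoothTopology.
Context (R : realType) (n : nat) (theta : 'M[R]_n).
Hypothesis theta_asym : theta^T = - theta.
Implicit Types (k : Zn n) (u : smooth theta) (beta : {ffun 'I_n -> nat}).

Definition decay_le (q : nat) (M : R) (u : Zn n -> R[i]) :=
  forall k, weight R k ^+ q * normc (u k) <= M.

Lemma smooth_decay u q : exists2 M, 0 < M & decay_le q M u.
Proof.
have /asboolP/(_ q)[M uM] := coef_rapid u.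
exists (`|M| + 1); first by rewrite ltr_pwDr.
by move=> k; apply: le_trans (uM k) _; rewrite (le_trans (ler_norm _))// lerDl.
Qed.

Lemma decay_leW q q' M M' (u : Zn n -> R[i]) : (q <= q')%N -> M <= M' ->
  decay_le q' M u -> decay_le q M' u.
Proof.
move=> qq' MM' uM k; apply: le_trans MM'; apply: le_trans (uM k).
by rewrite ler_wpM2r ?normc_ge0// ler_weXn2l// weight_ge1.
Qed.

Lemma decay_leZ q M c (u : Zn n -> R[i]) : decay_le q M u ->
  decay_le q (normc c * M) (fun k => c * u k).
Proof.
by move=> uM k; rewrite normcM mulrCA ler_wpM2l ?normc_ge0.
Qed.

Lemma decay_coef_le q M (u : Zn n -> R[i]) k : decay_le q M u ->
  normc (u k) <= M * (weight R k ^+ q)^-1.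
Proof.
by move=> uM; rewrite ler_pdivlMr ?exprn_gt0 ?weight_gt0// mulrC.
Qed.

Definition monomial_weight beta k : R[i] := \prod_(j < n) (k j)%:~R ^+ beta j.

Lemma normc_prod (I : finType) (F : I -> R[i]) :
  normc (\prod_i F i) = \prod_i normc (F i).
Proof. exact: (big_morph (@normc R) (@normcM R) (normc1 R)). Qed.

Lemma normcX (z : R[i]) m : normc (z ^+ m) = normc z ^+ m.
Proof. by elim: m => [|m IH]; rewrite ?expr0 ?normc1// !exprS normcM IH. Qed.

Lemma normc_int (m : int) : normc (m%:~R : R[i]) = `|m|%N%:R.
Proof.
have -> : (m%:~R : R[i]) = (m%:~R)%:C%C by rewrite rmorph_int.
by rewrite /normc/= expr0n/= addr0 sqrtr_sqr -intr_norm -abszE pmulrn.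
Qed.

Lemma monomial_weight_le beta k :
  normc (monomial_weight beta k) <= weight R k ^+ (\sum_j beta j).
Proof.
rewrite /monomial_weight normc_prod -prodrXr.
apply: ler_prod => j _; rewrite normc_ge0/= normcX normc_int.
by rewrite lerXn2r ?nnegrE ?weight_ge0 ?ler0n// coord_le_weight.
Qed.

Lemma monomial_decay beta q M (u : Zn n -> R[i]) :
  decay_le (q + \sum_j beta j) M u ->
  decay_le q M (fun k => monomial_weight beta k * u k).
Proof.
move=> uM k; rewrite normcM mulrA; apply: le_trans (uM k).
rewrite ler_wpM2r ?normc_ge0// exprD ler_wpM2l ?monomial_weight_le//.
by rewrite exprn_ge0// weight_ge0.
Qed.

Lemma decay_summable q M (u : Zn n -> R[i]) : (2 * n <= q)%N -> decay_le q M u ->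
  forall N, \sum_(k <- box_seq n N) normc (u k) <= M * 4 ^+ n.
Proof.
move=> nq uM; apply: weight_dominated => k; apply: decay_coef_le.
exact: decay_leW nq (lexx M) uM.
Qed.

Lemma decay_summable_family q M (u : Zn n -> R[i]) : (2 * n <= q)%N ->
  decay_le q M u -> summable_family u.
Proof. by move=> nq uM; exists (M * 4 ^+ n); exact: decay_summable nq uM. Qed.

Lemma smooth_seminorm_le beta u M : decay_le (2 * n + \sum_j beta j) M u ->
  smooth_seminorm beta u <= M * 4 ^+ n.
Proof.
move=> /monomial_decay uM; apply: cstar_norm_le => //.
exact: (decay_summable (leqnn _) uM).
Qed.

Lemma smooth_seminorm_ge beta u k :
  normc (monomial_weight beta k) * normc (u k) <= smooth_seminorm beta u.
Proof.
rewrite -normcM; apply: (coef_le_cstar_norm theta_asym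
  (u := fun k => monomial_weight beta k * u k)).
have [M _ /monomial_decay uM] := smooth_decay u (2 * n + \sum_j beta j).
exact: decay_summable_family (leqnn _) uM.
Qed.

(** [None] stands for the multi-index zero and [Some j] for [q] times the [j]-th
    unit vector. *)
Definition power_index (q : nat) (i : option 'I_n) : {ffun 'I_n -> nat} :=
  [ffun j => if i == Some j then q else 0%N].

(** One of the [n + 1] terms of the sum defining the weight is at least their
    average, so the weight is controlled by pure powers of the coordinates. *)
Lemma decay_of_seminorms q u e :
  (forall i, smooth_seminorm (power_index q i) u <= e) ->
  decay_le q (n.+1%:R ^+ q * e) u.
Proof.
move=> ue k; pose a (i : option 'I_n) : R := if i is Some j then `|k j|%N%:R else 1.
(* [a None] is the summand one of the weight. *)
have [i wa] : exists i, weight R k <= n.+1%:R * a i.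
  apply/not_existsP => h.
  have {}h i : n.+1%:R * a i < weight R k by rewrite ltNge; apply/negP/h.
  have : \sum_(j < n) n.+1%:R * a (Some j) <= \sum_(j < n) weight R k.
    by apply: ler_sum => j _; exact/ltW.
  rewrite sumr_const card_ord -mulr_sumr -mulr_natl -/(a _) => h1.
  have h2 := h None.
  have e1 : weight R k = 1 + \sum_(j < n) a (Some j) by [].
  move: h1 h2; rewrite /a -/a -natr1 e1; set S := \sum_(j < n) _; nra.
have am : a i ^+ q <= normc (monomial_weight (power_index q i) k) .
  rewrite /monomial_weight normc_prod; case: i {wa} => [j|]/=.
    rewrite (bigD1 j)//= ffunE eqxx big1 ?mulr1; last first.
      move=> l lj; rewrite ffunE ifN ?expr0 ?normc1//.
      by rewrite eq_sym; apply: contra lj => /eqP[->].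
    by rewrite normcX normc_int.
  rewrite expr1n big1// => l _; by rewrite ffunE expr0 normc1.
apply: (@le_trans _ _ (n.+1%:R ^+ q * (a i ^+ q * normc (u k)))).
  rewrite mulrA -exprMn ler_wpM2r ?normc_ge0// lerXn2r ?nnegrE ?weight_ge0//.
  exact: le_trans (weight_ge0 _ _) wa.
rewrite ler_wpM2l ?exprn_ge0//; apply: le_trans (ue i).
apply: le_trans (smooth_seminorm_ge _ _ k).
by rewrite ler_wpM2r ?normc_ge0.
Qed.

(** A seminorm of order [|beta|] is at most a weighted sup norm whose exponent
    exceeds [|beta|] by the [2 n] that make the weights summable; conversely
    [n + 1] seminorms control each weighted sup norm.  A single such norm is enough
    since they increase with the exponent. *)
Lemma nbhs_smoothP u (V : set (smooth theta)) :
  nbhs u V <-> exists q M, 0 < M /\ [set v | decay_le q M (v - u : smooth theta)] `<=` V.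
Proof.
split.
  move=> [m [i [e [e0 iV]]]].
  pose q := (2 * n + \sum_(j < m) \sum_l i j l)%N.
  exists q, (e / 2 / 4 ^+ n); split; first by rewrite !divr_gt0// exprn_gt0.
  move=> v vM; apply: iV => j /=.
  apply: (@le_lt_trans _ _ (e / 2)); last by rewrite ltr_pdivrMr// mulr_natr mulr2n ltrDl.
  rewrite -[leRHS](divfK (x := 4 ^+ n)) ?expf_neq0// ?pnatr_eq0//.
  apply: smooth_seminorm_le; apply: decay_leW (lexx _) vM.
  by rewrite leq_add2l (bigD1 j)//= leq_addr.
move=> [q [M [M0 MV]]].
pose e := M / n.+1%:R ^+ q.
have e0 : 0 < e by rewrite divr_gt0// exprn_gt0.
exists #|{: option 'I_n}|, (fun j => power_index q (enum_val j)), e; split=> //.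
move=> v /= ve; apply: MV => /=.
have Me : n.+1%:R ^+ q * e <= M by rewrite mulrC divfK// expf_neq0.
apply: (decay_leW (leqnn q) Me).
apply: (decay_of_seminorms (u := v - u)) => i; apply/ltW.
by have := ve (enum_rank i); rewrite enum_rankK.
Qed.

Lemma smooth_boundedP (B : set (smooth theta)) :
  smooth_bounded B <-> forall q, exists2 M, 0 < M & forall u, B u -> decay_le q M u.
Proof.
split=> [Bb q|Bb beta].
  pose M i := projT1 (cid (Bb (power_index q i))).
  pose L := \sum_i `|M i| + 1.
  have L0 : 0 < L by rewrite ltr_pwDr// sumr_ge0.
  exists (n.+1%:R ^+ q * L); first by rewrite mulr_gt0// exprn_gt0.
  move=> u Bu; apply: decay_of_seminorms => i.
  have := projT2 (cid (Bb (power_index q i))) u Bu; rewrite -/(M i).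
  move=> /le_trans; apply; rewrite /L (bigD1 i)//= -addrA.
  by apply: (le_trans (ler_norm _)); rewrite lerDl addr_ge0// sumr_ge0.
have [M _ BM] := Bb (2 * n + \sum_j beta j)%N.
by exists (M * 4 ^+ n) => u /BM; exact: smooth_seminorm_le.
Qed.

End SmoothTopology.

(** * The embedding of the algebra in its dual *)

Section Dual.
Context (R : realType) (n : nat) (theta : 'M[R]_n).
Hypothesis theta_asym : theta^T = - theta.
Implicit Types (k l : Zn n) (u v : smooth theta) (f g : smooth_dual theta).

Lemma normc_cocycle k l : normc (cocycle theta k l) = 1.
Proof. exact: normc_expi. Qed.

Lemma cocycle_neq0 k l : cocycle theta k l != 0.
Proof.
by apply: contra_eq_neq (normc_cocycle k l) => ->; rewrite normc0 eq_sym oner_eq0.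
Qed.

Lemma smooth_eqP u v : (forall k, u k = v k) -> u = v.
Proof. by move=> uv; apply: val_inj; apply/funext. Qed.

Lemma smooth_addE u v k : (u + v : smooth theta) k = u k + v k.
Proof. by []. Qed.

Lemma smooth_subE u v k : (u - v : smooth theta) k = u k - v k.
Proof. by []. Qed.

Lemma smooth_scaleE c u k : (c *: u : smooth theta) k = c * u k.
Proof. by []. Qed.

Lemma smooth_bounded_coef u : exists2 M, 0 < M & forall k, normc (u k) <= M.
Proof.
have [M M0 uM] := smooth_decay u 0; exists M => // k.
by have := uM k; rewrite expr0 mul1r.
Qed.

Definition pairing (u v : Zn n -> R[i]) : R[i] := tau (tmul theta u v).

Lemma pairing_term_le (u v : Zn n -> R[i]) M L k :
  decay_le (2 * n) M u -> (forall k, normc (v k) <= L) ->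
  normc (cocycle theta k (0 - k) * u k * v (0 - k)) <=
    M * L * (weight R k ^+ (2 * n))^-1.
Proof.
move=> uM vL; rewrite !normcM normc_cocycle mul1r mulrAC.
by rewrite ler_pM ?normc_ge0//; exact: decay_coef_le.
Qed.

Lemma pairing_le (u v : Zn n -> R[i]) M L :
  decay_le (2 * n) M u -> (forall k, normc (v k) <= L) ->
  normc (pairing u v) <= M * L * 4 ^+ n.
Proof.
move=> uM vL; apply: normc_sumZ_le; apply: weight_dominated => k.
exact: pairing_term_le uM vL.
Qed.

Lemma pairing_summable u v :
  summable_family (fun k => cocycle theta k (0 - k) * u k * v (0 - k)).
Proof.
have [M _ uM] := smooth_decay u (2 * n); have [L _ vL] := smooth_bounded_coef v.
exists (M * L * 4 ^+ n); apply: weight_dominated => k.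
exact: pairing_term_le uM vL.
Qed.

Lemma pairing_linearl u u' v c :
  pairing (c *: u + u') v = c * pairing u v + pairing u' v.
Proof.
rewrite /pairing /tau /tmul -sumZZ; last exact: pairing_summable.
rewrite -sumZD; [|exact/summable_familyZ/pairing_summable|exact: pairing_summable].
by apply: eq_sumZ => k; rewrite smooth_addE smooth_scaleE; ring.
Qed.

Lemma pairing_linearr u v v' c :
  pairing u (c *: v + v') = c * pairing u v + pairing u v'.
Proof.
rewrite /pairing /tau /tmul -sumZZ; last exact: pairing_summable.
rewrite -sumZD; [|exact/summable_familyZ/pairing_summable|exact: pairing_summable].
by apply: eq_sumZ => k; rewrite smooth_addE smooth_scaleE; ring.
Qed.

Lemma pairing_Ubasisl l v :
  pairing (Ubasis theta l) v = cocycle theta l (0 - l) * v (0 - l).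
Proof.
rewrite /pairing /tau /tmul (sumZ_single (k := l)) /= => [|k kl].
  by rewrite eqxx mulr1.
by rewrite (negbTE kl) mulr0 mul0r.
Qed.

Lemma pairing_Ubasisr u l :
  pairing u (Ubasis theta (0 - l)) = cocycle theta l (0 - l) * u l.
Proof.
rewrite /pairing /tau /tmul (sumZ_single (k := l)) /= => [|k kl].
  by rewrite eqxx mulr1.
rewrite (_ : _ == _ = false) ?mulr0//; apply: contra_neqF kl => /eqP.
by rewrite !sub0r => /oppr_inj.
Qed.

(** Continuity at the origin gives the estimate after rescaling, which is why [M]
    is positive. *)
Lemma continuous_functionalP (f : smooth theta -> R[i]^o) : linear f ->
  continuous f <-> exists q C, 0 < C /\
    forall u M, 0 < M -> decay_le q M u -> normc (f u) <= C * M.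
Proof.
move=> lf.
have f0 : f 0 = 0 by have := lf (-1) 0 0; rewrite scaler0 addr0 scaleN1r addNr.
have fZ c u : f (c *: u) = c * f u by have := lf c u 0; rewrite f0 !addr0.
have fB u v : f (u - v) = f u - f v.
  by rewrite addrC -scaleN1r lf scaleN1r addrC.
split=> [cf|[q [C [C0 fC]]]].
  have /cvg_complexP/(_ 1 ltr01)/(nbhs_smoothP theta_asym) := cf 0.
  move=> [q [M0 [M00 h]]].
  exists q, M0^-1; split; first by rewrite invr_gt0.
  move=> u M M_gt0 uM.
  have c0 : 0 <= M0 / M by rewrite divr_ge0// ltW.
  have /h : decay_le q M0 ((M0 / M)%:C%C *: u - 0 : smooth theta).
    have := decay_leZ (M0 / M)%:C%C uM.
    by rewrite subr0 normc_real// divfK// gt_eqF.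
  rewrite /= f0 sub0r normcN fZ.
  rewrite normcM normc_real// mulrAC ltr_pdivrMr// mul1r => /ltW.
  by rewrite mulrC -ler_pdivlMr// mulrC.
move=> u; apply/cvg_complexP => e e0; apply/(nbhs_smoothP theta_asym).
exists q, (e / 2 / C); split; first by rewrite !divr_gt0.
move=> v /= uv; rewrite -normcN opprB -fB.
have eC : 0 < e / 2 / C by rewrite !divr_gt0.
apply: (le_lt_trans (fC (v - u) _ eC uv)).
by rewrite mulrC divfK ?gt_eqF// ltr_pdivrMr// mulr_natr mulr2n ltrDl.
Qed.

Lemma pairing_continuous u : continuous (pairing u : smooth theta -> R[i]^o).
Proof.
have lu : linear (pairing u : smooth theta -> R[i]^o).
  by move=> c v v'; exact: pairing_linearr.
apply/(continuous_functionalP lu).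
have [M M0 uM] := smooth_decay u (2 * n).
exists 0%N, (M * 4 ^+ n); split; first by rewrite mulr_gt0// exprn_gt0.
move=> v L L0 vL; rewrite mulrAC; apply: pairing_le => // k.
by have := vL k; rewrite expr0 mul1r.
Qed.

Lemma pairing_dual u :
  (pairing u : smooth theta -> R[i]^o) \in @dual_pred R n theta.
Proof.
apply/asboolP; split; last exact: pairing_continuous.
by move=> c v v'; exact: pairing_linearr.
Qed.

Definition embed u : smooth_dual theta := SmoothDual (pairing_dual u).

Lemma dual_eqP f g : (forall u, f u = g u) -> f = g.
Proof. by move=> fg; apply: val_inj; apply/funext. Qed.

Lemma represents_embed f u : represents f u -> f = embed u.
Proof. by move=> fu; apply: dual_eqP => v; rewrite fu. Qed.

Lemma embed_inj : injective embed.
Proof.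
move=> u v uv; apply: smooth_eqP => k.
have : embed u (Ubasis theta (0 - k)) = embed v (Ubasis theta (0 - k)) by rewrite uv.
rewrite /= !pairing_Ubasisr; apply: mulfI; exact: cocycle_neq0.
Qed.

Lemma embed_linear : linear embed.
Proof. by move=> c u v; apply: dual_eqP => w; exact: pairing_linearl. Qed.

HB.instance Definition _ := GRing.isLinear.Build R[i] _ _ _ embed embed_linear.

Lemma dual_linear f : linear f.
Proof. by have /asboolP[] := dual_funP f. Qed.

Lemma dual_continuous f : continuous f.
Proof. by have /asboolP[] := dual_funP f. Qed.

Lemma dual_bounded f (B : set (smooth theta)) : smooth_bounded B ->
  exists2 M, 0 < M & forall u, B u -> normc (f u) <= M.
Proof.
move=> /(smooth_boundedP theta_asym) Bb.
have [q [C [C0 fC]]] := proj1 (continuous_functionalP (dual_linear f)) (@dual_continuous f).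
have [M M0 BM] := Bb q; exists (C * M); first by rewrite mulr_gt0.
by move=> u /BM; exact: fC.
Qed.

Lemma nbhs_dualP f (V : set (smooth_dual theta)) :
  nbhs f V <-> exists B : set (smooth theta), smooth_bounded B /\ exists e : R,
    0 < e /\ [set g : smooth_dual theta | forall u, B u -> normc (g u - f u) <= e] `<=` V.
Proof.
split.
  move=> [m [i [e [e0 iV]]]].
  exists (\bigcup_(j in [set: 'I_m]) sval (i j)); split.
    apply/(smooth_boundedP theta_asym) => q.
    pose M j := sval (cid2 (proj1 (smooth_boundedP theta_asym _) (svalP (i j)) q)).
    have M0 j : 0 < M j by rewrite /M; case: cid2.
    have iM j u : sval (i j) u -> decay_le q (M j) u by rewrite /M; case: cid2 => /= ? _; exact.
    exists (\sum_j M j + 1); first by rewrite ltr_pwDr// sumr_ge0// => j _; exact/ltW.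
    move=> u [j _ /iM]; apply: decay_leW => //.
    by rewrite (bigD1 j)//= -addrA lerDl addr_ge0// sumr_ge0// => l _; exact/ltW.
  exists (e / 2); split; first by rewrite divr_gt0.
  move=> g /= gf; apply: iV => j; rewrite /strong_seminorm.
  have e2 : e / 2 < e by rewrite ltr_pdivrMr// mulr_natr mulr2n ltrDl.
  apply: le_lt_trans e2; set A := [set _ | _ in _].
  have [->|A0] := eqVneq A set0; first by rewrite sup0 divr_ge0// ltW.
  apply: ge_sup; first exact/set0P.
  by move=> _ [u Bu <-]; apply: gf; exists j.
move=> [B [Bb [e [e0 BV]]]].
exists 1%N, (fun=> exist _ B Bb), e; split=> //.
move=> g /= /(_ ord0) gf; apply: BV => u Bu; apply: le_trans (ltW gf).
apply: ub_le_sup; last by exists u.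
have [M _ BM] := dual_bounded (g - f) Bb.
by exists M => _ [w Bw <-]; exact: BM.
Qed.

(** One bounded set [B] suffices because the finitely many ones that witness the
    continuity of [S] at the origin have a bounded union. *)
Lemma continuous_dual_smoothP (S : {linear smooth_dual theta -> smooth theta}) :
  continuous S <-> forall q, exists B : set (smooth theta), smooth_bounded B /\
    exists C, 0 < C /\ forall f M, 0 < M ->
      (forall u, B u -> normc (f u) <= M) -> decay_le q (C * M) (S f).
Proof.
split=> [cS q|h f V].
  have : nbhs (S 0) [set v : smooth theta | decay_le q 1 v].
    apply/(nbhs_smoothP theta_asym); exists q, 1; split=> //.
    by move=> v /=; rewrite linear0 subr0.
  move=> /(cS 0)/nbhs_dualP[B [Bb [e [e0 Be]]]].
  exists B; split=> //; exists e^-1; split; first by rewrite invr_gt0.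
  move=> f M M0 fM.
  have c0 : 0 < e / M by rewrite divr_gt0.
  have /Be : forall u, B u ->
      normc (((e / M)%:C%C *: f : smooth_dual theta) u - (0 : smooth_dual theta) u) <= e.
    move=> u Bu; rewrite subr0 normcM normc_real; last exact: ltW.
    by rewrite mulrAC ler_pdivrMr// ler_pM2l// fM.
  rewrite /= linearZ => h k; have := h k.
  rewrite smooth_scaleE normcM normc_real; last exact: ltW.
  by rewrite mulrCA -ler_pdivlMl// mulr1 invf_div (mulrC M).
move=> /(nbhs_smoothP theta_asym)[q [M [M0 MV]]].
have [B [Bb [C [C0 BC]]]] := h q.
apply/nbhs_dualP; exists B; split=> //; exists (M / C); split; first by rewrite divr_gt0.
move=> g /= gf; apply: MV => /=.
have := BC (g - f) (M / C) (divr_gt0 M0 C0) gf.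
by rewrite linearB mulrC divfK// gt_eqF.
Qed.

End Dual.

(** * Smoothing operators are the rapidly decaying matrices *)

Section RapidMatrices.
Context (R : realType) (n : nat) (theta : 'M[R]_n).
Hypothesis theta_asym : theta^T = - theta.
Implicit Types (k l : Zn n) (u v : smooth theta) (f g : smooth_dual theta).
Implicit Types (T : {linear smooth theta -> smooth_dual theta}).

Definition rapid_matrix (t : Zn n -> Zn n -> R[i]) :=
  forall p q, exists M, forall k l,
    weight R k ^+ p * weight R l ^+ q * normc (t k l) <= M.

Definition matrix_action (t : Zn n -> Zn n -> R[i]) (u : Zn n -> R[i]) k : R[i] :=
  sumZ (fun l => t k l * u l).

Section MatrixOperator.
Variables (t : Zn n -> Zn n -> R[i]) (rt : rapid_matrix t).

(** The inverse of the cocycle cancels the one in [U^l U^(-l)]. *)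
Definition row_coef k (m : Zn n) : R[i] :=
  (cocycle theta (- m) m)^-1 * t k (- m).

Lemma row_decay p q : exists2 M, 0 < M &
  forall k, decay_le p M (fun m => (weight R k ^+ q)%:C%C * row_coef k m).
Proof.
have [M tM] := rt q p; exists (`|M| + 1); first by rewrite ltr_pwDr.
move=> k m; rewrite /row_coef !normcM normcV normc_cocycle invr1 mul1r.
rewrite normc_real ?exprn_ge0 ?weight_ge0// mulrA -(weightN R m) (mulrC (_ ^+ p)).
apply: le_trans (tM k (- m)) _.
by rewrite (le_trans (ler_norm _))// lerDl.
Qed.

Lemma row_rapid k : (row_coef k : Zn n -> R[i]^o) \in @rapid_pred R n.
Proof.
apply/asboolP => p; have [M _ rM] := row_decay p 0; exists M => m.
by have := rM k m; rewrite expr0 mul1r.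
Qed.

(** The functional [v |-> tau (u v)] takes at [matrix_row k] the [k]-th
    coefficient of the image of [u] under [t]; the extension of the operator to
    the dual is therefore [f |-> (f (matrix_row k))_k]. *)
Definition matrix_row k : smooth theta := Smooth theta (row_rapid k).

Lemma pairing_row u k : pairing theta u (matrix_row k) = matrix_action t u k.
Proof.
apply: eq_sumZ => l; rewrite /= /row_coef sub0r opprK.
by rewrite mulrACA mulfV ?cocycle_neq0// mul1r mulrC.
Qed.

(** The rows multiplied by powers of the weight of their index still form a
    bounded set; testing functionals on it expresses the continuity of the
    extension. *)
Definition weighted_rows q : set (smooth theta) :=
  range (fun k => (weight R k ^+ q)%:C%C *: matrix_row k).

Lemma weighted_rows_bounded q : smooth_bounded (weighted_rows q).
Proof.
apply/(smooth_boundedP theta_asym) => p; have [M M0 rM] := row_decay p q.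
by exists M => // _ [k _ <-] m; exact: rM.
Qed.

Lemma dual_scale f c u : f (c *: u) = c * f u.
Proof.
have f0 : f 0 = 0.
  by have := dual_linear f (-1) 0 0; rewrite scaler0 addr0 scaleN1r addNr.
by have := dual_linear f c u 0; rewrite f0 !addr0.
Qed.

Lemma dual_row_decay f q M : (forall u, weighted_rows q u -> normc (f u) <= M) ->
  decay_le q M (fun k => f (matrix_row k)).
Proof.
move=> fM k; have := fM _ (imageT (fun k => (weight R k ^+ q)%:C%C *: matrix_row k) k).
by rewrite dual_scale normcM normc_real// exprn_ge0// weight_ge0.
Qed.

Lemma dual_row_rapid f :
  ((fun k => f (matrix_row k)) : Zn n -> R[i]^o) \in @rapid_pred R n.
Proof.
apply/asboolP => q.
have [M _ fM] := dual_bounded theta_asym f (weighted_rows_bounded q).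
by exists M; exact: dual_row_decay fM.
Qed.

Definition matrix_extension f : smooth theta := Smooth theta (dual_row_rapid f).

Lemma matrix_extension_linear : linear matrix_extension.
Proof. by move=> c f g; apply: smooth_eqP. Qed.

HB.instance Definition _ := GRing.isLinear.Build R[i] _ _ _
  matrix_extension matrix_extension_linear.

Definition matrix_operator u : smooth_dual theta :=
  embed theta_asym (matrix_extension (embed theta_asym u)).

Lemma matrix_operator_linear : linear matrix_operator.
Proof. by move=> c u v; rewrite /matrix_operator !linearP. Qed.

HB.instance Definition _ := GRing.isLinear.Build R[i] _ _ _
  matrix_operator matrix_operator_linear.

End MatrixOperator.

Lemma smoothing_embed T : smoothing T ->
  forall u, T u = embed theta_asym (corestr T u).
Proof.
move=> [Tr _] u; apply: represents_embed; have [w Tw] := Tr u.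
exact: (@xgetI _ 0 [set w | represents (T u) w] w Tw).
Qed.

Lemma corestr_eq T u w : T u = embed theta_asym w -> corestr T u = w.
Proof.
move=> Tuw; have Rw : represents (T u) w by rewrite Tuw.
apply/(@embed_inj _ _ _ theta_asym); rewrite -Tuw; apply/esym/represents_embed.
exact: (@xgetI _ 0 [set w | represents (T u) w] w Rw).
Qed.

(** The extension to the dual is continuous since a weighted sup norm of its value
    at [f] is the supremum of [f] over a bounded set of weighted rows. *)
Lemma matrix_smoothing (t : Zn n -> Zn n -> R[i]) : rapid_matrix t ->
  exists2 T, smoothing T & forall u k, corestr T u k = matrix_action t u k.
Proof.
move=> rt; exists (matrix_operator rt).
  split=> [u|]; first by exists (matrix_extension rt (embed theta_asym u)).
  exists (matrix_extension rt); last first.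
    by move=> u f /(represents_embed theta_asym) ->.
  apply/(continuous_dual_smoothP theta_asym) => q.
  exists (weighted_rows rt q); split; first exact: weighted_rows_bounded.
  exists 1; split=> // f M M0 fM; rewrite mul1r.
  exact: dual_row_decay fM.
move=> u k; rewrite (@corestr_eq _ _ (matrix_extension rt (embed theta_asym u)))//.
by rewrite /= pairing_row.
Qed.

Lemma matrix_action_summable (t : Zn n -> Zn n -> R[i]) u k : rapid_matrix t ->
  summable_family (fun l => t k l * u l).
Proof.
move=> rt; have [M tM] := rt 0 (2 * n); have [L L0 uL] := smooth_bounded_coef u.
exists (M * L * 4 ^+ n); apply: weight_dominated => l.
rewrite normcM mulrAC ler_pM ?normc_ge0//.
by rewrite ler_pdivlMr ?exprn_gt0 ?weight_gt0// mulrC; have := tM k l; rewrite expr0 mul1r.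
Qed.

(** Density of the finite sums of monomials: outside the cube of size [N] the
    weight is at least [N + 1], so the norm with exponent [q] of the tail of [u] is at
    most the norm of [u] with exponent [q + 1] divided by [N + 1]. *)
Lemma linear_functional_eq0 (phi : smooth theta -> R[i]^o) q C : linear phi ->
  (forall u M, 0 < M -> decay_le q M u -> normc (phi u) <= C * M) ->
  (forall l, phi (Ubasis theta l) = 0) -> forall u, phi u = 0.
Proof.
move=> lphi bphi phi0 u.
have phi00 : phi 0 = 0 by have := lphi (-1) 0 0; rewrite scaler0 addr0 scaleN1r addNr.
have phis (s : seq (Zn n)) : phi (\sum_(l <- s) u l *: Ubasis theta l) = 0.
  elim: s => [|l s IH]; first by rewrite big_nil.
  by rewrite big_cons lphi phi0 IH scaler0 addr0.
have [K K0 uK] := smooth_decay u q.+1.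
apply: eq0_normc; apply/eqP; rewrite eq_le normc_ge0 andbT.
(* [phi u] is the value of [phi] at the tail of [u]. *)
have bound N : normc (phi u) <= C * (K / N.+1%:R).
  pose uN := \sum_(l <- box_seq n N) u l *: Ubasis theta l.
  have -> : phi u = phi (u - uN).
    by rewrite addrC -scaleN1r lphi phis scaler0 add0r.
  apply: bphi; first by rewrite divr_gt0.
  move=> k.
  have uNk : uN k = if k \in box_seq n N then u k else 0.
    rewrite /uN (big_morph (fun v : smooth theta => v k) (id1 := 0)
      (op1 := +%R))//; under eq_bigr do rewrite smooth_scaleE /=.
    case: ifPn => kN; last first.
      rewrite big1_seq// => l /= lN; rewrite (_ : k == l = false) ?mulr0//.
      by apply: contraNF kN => /eqP->.
    rewrite (bigD1_seq k)//= ?box_seq_uniq// eqxx mulr1 big1 ?addr0// => l lk.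
    by rewrite eq_sym (negbTE lk) mulr0.
  rewrite smooth_subE uNk; case: ifPn => kN.
    by rewrite subrr normc0 mulr0 divr_ge0// ltW.
  rewrite subr0 ler_pdivlMr// mulrAC; apply: le_trans (uK k).
  rewrite exprSr -!mulrA ler_wpM2l ?exprn_ge0 ?weight_ge0//.
  rewrite ler_wpM2r ?normc_ge0//.
  move: kN; rewrite mem_box_seq negb_forall => /existsP[j]; rewrite -ltnNge => kj.
  by apply: le_trans (coord_le_weight R k j); rewrite ler_nat.
apply/ler_addgt0Pr => e e0; rewrite add0r.
have [N hN] : exists N : nat, `|C * K| / e < N.+1%:R.
  exists (Num.bound (`|C * K| / e)); apply: lt_trans (archi_boundP _) _.
    by rewrite divr_ge0// ltW.
  by rewrite ltr_nat.
apply: le_trans (bound N) _; rewrite mulrA ler_pdivrMr//.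
apply: le_trans (ler_norm _) _.
by rewrite (mulrC e) -ler_pdivrMr// ltW.
Qed.

(** The functional embedding [U^l] is of size [weight l ^- q] on a given bounded
    set, for every [q]: this gives the decay of [t k l] in [l], and the norms of the
    algebra give its decay in [k].  That [T] acts through its matrix holds on
    the monomials, hence everywhere by continuity. *)
Lemma smoothing_matrix T : smoothing T ->
  exists2 t, rapid_matrix t & forall u k, corestr T u k = matrix_action t u k.
Proof.
move=> [_ [S cS TS]].
have TE u : corestr T u = S (embed theta_asym u).
  by apply: corestr_eq; apply: represents_embed; exact: TS.
pose t k l := S (embed theta_asym (Ubasis theta l)) k.
have bS := proj1 (continuous_dual_smoothP theta_asym S) cS.
have rt : rapid_matrix t.
  move=> p q; have [B [Bb [C [C0 SC]]]] := bS p.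
  have [M M0 BM] := proj1 (smooth_boundedP theta_asym B) Bb q.
  exists (C * M) => k l.
  have w0 : 0 < weight R l ^+ q by rewrite exprn_gt0// weight_gt0.
  rewrite mulrAC -ler_pdivlMr// -mulrA; apply: SC; first by rewrite divr_gt0.
  move=> v Bv; rewrite /= pairing_Ubasisl normcM normc_cocycle mul1r.
  by rewrite sub0r -(weightN R l); apply: decay_coef_le; exact: BM.
exists t => // u k; rewrite TE; apply/eqP; rewrite -subr_eq0; apply/eqP.
move: u; pose phi u : R[i]^o := S (embed theta_asym u) k - matrix_action t u k.
have [B [Bb [C [C0 SC]]]] := bS 0%N.
have [M M0 BM] := proj1 (smooth_boundedP theta_asym B) Bb 0%N.
have [L tL] := rt 0%N 0%N.
apply: (@linear_functional_eq0 phi (2 * n) (C * (M * 4 ^+ n) + L * 4 ^+ n)).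
- move=> c u v; rewrite /phi /matrix_action linearP linearP smooth_addE smooth_scaleE.
  rewrite (eq_sumZ (g := fun l => c * (t k l * u l) + t k l * v l)); last first.
    by move=> l; rewrite smooth_addE smooth_scaleE; ring.
  have su := matrix_action_summable u k rt; have sv := matrix_action_summable v k rt.
  rewrite sumZD//; last exact: summable_familyZ.
  rewrite sumZZ//.
  by rewrite /GRing.scale/=; ring.
- move=> u K K0 uK; rewrite /phi; apply: le_trans (le_normcD _ _) _.
  rewrite normcN mulrDl; apply: lerD.
    have -> : C * (M * 4 ^+ n) * K = C * (K * M * 4 ^+ n) by ring.
    have := SC (embed theta_asym u) (K * M * 4 ^+ n) _ _ k.
    rewrite expr0 mul1r; apply; first by rewrite !mulr_gt0// exprn_gt0.
    move=> v Bv; apply: pairing_le => // m.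
    by have := BM v Bv m; rewrite expr0 mul1r.
  have -> : L * 4 ^+ n * K = L * K * 4 ^+ n by ring.
  apply: normc_sumZ_le; apply: weight_dominated => l.
  rewrite normcM -mulrA ler_pM ?normc_ge0//; last exact: decay_coef_le.
  by have := tL k l; rewrite !expr0 !mul1r.
- move=> l; rewrite /phi /matrix_action (sumZ_single (k := l)) /=.
    by rewrite eqxx mulr1 subrr.
  by move=> m ml; rewrite (negbTE ml) mulr0.
Qed.

End RapidMatrices.

(** * Commutators of rapidly decaying matrices *)

Section Commutators.
Context (R : realType) (n : nat).
Implicit Types (k l j : Zn n) (t b r : Zn n -> Zn n -> R[i]) (x y : Zn n -> R[i]).

Lemma weight0 : weight R (0 : Zn n) = 1.
Proof. by rewrite /weight big1 ?addr0// => j _; rewrite ffunE. Qed.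

Lemma rapid_matrixD t b : rapid_matrix t -> rapid_matrix b ->
  rapid_matrix (fun k l => t k l + b k l).
Proof.
move=> rt rb p q; have [M tM] := rt p q; have [L bL] := rb p q.
exists (M + L) => k l; apply: le_trans (lerD (tM k l) (bL k l)).
rewrite -mulrDr ler_wpM2l ?le_normcD//.
by rewrite mulr_ge0// exprn_ge0// weight_ge0.
Qed.

Lemma rapid_outer x y : rapidly_decaying x -> rapidly_decaying y ->
  rapid_matrix (fun k l => x k * y l).
Proof.
move=> rx ry p q; have [M xM] := rx p; have [L yL] := ry q.
exists (M * L) => k l; rewrite normcM mulrACA ler_pM ?xM ?yL//.
  by rewrite mulr_ge0 ?exprn_ge0 ?weight_ge0 ?normc_ge0.
by rewrite mulr_ge0 ?exprn_ge0 ?weight_ge0 ?normc_ge0.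
Qed.

Lemma rapid_diagonal_part t : rapid_matrix t -> rapidly_decaying (fun k => t k k).
Proof.
move=> rt p; have [M tM] := rt p 0; exists M => k.
by have := tM k k; rewrite expr0 mulr1.
Qed.

Lemma rapid_diagonal x : rapidly_decaying x ->
  rapid_matrix (fun k l => (k == l)%:R * x k).
Proof.
move=> rx p q; have [M xM] := rx (p + q)%N; have M0 : 0 <= M.
  by apply: le_trans (xM 0); rewrite mulr_ge0 ?normc_ge0// exprn_ge0// weight_ge0.
exists M => k l; have [<-|_] := eqVneq k l; first by rewrite mul1r -exprD xM.
by rewrite mul0r normc0 mulr0.
Qed.

Lemma rapid_delta : rapidly_decaying (fun k : Zn n => (k == 0)%:R : R[i]).
Proof.
move=> p; exists 1 => k; have [->|_] := eqVneq k 0; last by rewrite normc0 mulr0.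
by rewrite normc1 mulr1 -[1 + _]/(weight R 0) weight0 expr1n.
Qed.

Lemma rapidly_decayingZ c x : rapidly_decaying x -> rapidly_decaying (fun k => c * x k).
Proof.
move=> rx p; have [M xM] := rx p; exists (normc c * M) => k.
by rewrite normcM mulrCA ler_wpM2l ?normc_ge0.
Qed.

Lemma sqr_le_bound (z M : R) : z ^+ 2 <= M -> z <= 1 + M.
Proof. nra. Qed.

(** Take the bound on [t] with twice the exponents. *)
Lemma rapid_matrix_sqrt t b : rapid_matrix t ->
  (forall k l, normc (b k l) ^+ 2 <= normc (t k l)) -> rapid_matrix b.
Proof.
move=> rt bt p q; have [M tM] := rt (p * 2)%N (q * 2)%N.
exists (1 + M) => k l; apply: sqr_le_bound; apply: le_trans (tM k l).
by rewrite !exprMn -!exprM ler_wpM2l// mulr_ge0// exprn_ge0// weight_ge0.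
Qed.

Lemma rapidly_decaying_sqrt x y : rapidly_decaying x ->
  (forall k, normc (y k) ^+ 2 <= normc (x k)) -> rapidly_decaying y.
Proof.
move=> rx yx p; have [M xM] := rx (p * 2)%N.
exists (1 + M) => k; apply: sqr_le_bound; apply: le_trans (xM k).
by rewrite !exprMn -!exprM ler_wpM2l// exprn_ge0// (weight_ge0 R k).
Qed.

(** The first factor is [sqrt |z|]. *)
Lemma factor_sqrt (z : R[i]) : exists v w : R[i],
  [/\ v * w = z, normc v ^+ 2 <= normc z & normc w ^+ 2 <= normc z].
Proof.
pose s := Num.sqrt (normc z); have s2 : s ^+ 2 = normc z by rewrite sqr_sqrtr ?normc_ge0.
have [z0|z0] := eqVneq (normc z) 0.
  exists 0, 0; rewrite (eq0_normc z0) mulr0 normc0 expr0n/=; split=> //.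
have s0 : s != 0 by rewrite -sqrf_eq0 s2.
exists s%:C%C, (s%:C%C^-1 * z); split.
- by rewrite mulVKf// eq_complex /= (negbTE s0).
- by rewrite normc_real ?sqrtr_ge0// s2.
rewrite normcM normcV normc_real ?sqrtr_ge0// -s2 exprMn exprVn.
by rewrite [X in _ * X]expr2 mulKf ?sqrf_eq0.
Qed.

Lemma rapidly_decaying_factor x : rapidly_decaying x ->
  exists y z : Zn n -> R[i], [/\ rapidly_decaying y, rapidly_decaying z &
    forall k, y k * z k = x k].
Proof.
move=> rx; have [y yP] := choice (fun k => factor_sqrt (x k)).
have [z zP] := choice yP.
exists y, z; split=> [||k]; last by have [] := zP k.
  by apply: rapidly_decaying_sqrt rx _ => k; have [] := zP k.
by apply: rapidly_decaying_sqrt rx _ => k; have [] := zP k.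
Qed.

(** A total order on the lattice for which the weight is nondecreasing. *)
Definition lattice_le k l : bool :=
  (weight R k < weight R l) ||
  (weight R k == weight R l) && (pickle k <= pickle l)%N.

Lemma lattice_le_refl k : lattice_le k k.
Proof. by rewrite /lattice_le eqxx leqnn orbT. Qed.

Lemma lattice_le_weight k l : lattice_le k l -> weight R k <= weight R l.
Proof. by case/orP => [/ltW//|/andP[/eqP->]]. Qed.

Lemma lattice_le_trans j k l : lattice_le k j -> lattice_le j l -> lattice_le k l.
Proof.
rewrite /lattice_le => /orP[kj|/andP[/eqP-> pkj]] /orP[jl|/andP[/eqP<- pjl]].
- by rewrite (lt_trans kj jl).
- by rewrite kj.
- by rewrite jl.
- by rewrite eqxx (leq_trans pkj pjl) orbT.
Qed.

Lemma lattice_le_total k l : k != l ->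
  lattice_le k l && ~~ lattice_le l k || lattice_le l k && ~~ lattice_le k l.
Proof.
move=> kl; rewrite /lattice_le; have [//|//|_/=] := ltgtP (weight R k) (weight R l).
rewrite -!ltnNge; have [//|//|/(pcan_inj pickleK) e] := ltngtP (pickle k) (pickle l).
by rewrite e eqxx in kl.
Qed.

Lemma real_term_le_sumZ (h : Zn n -> R) k : (forall j, 0 <= h j) ->
  summable_family (fun j => (h j)%:C%C) ->
  h k <= normc (sumZ (fun j => (h j)%:C%C)).
Proof.
move=> h0 sh; apply/ler_addgt0Pr => e e0.
have /cvg_complexP/(_ e e0) ch := sumZ_cvg sh.
near \oo => N.
have kN : k \in box_seq n N by apply: mem_box_seq_norm; near: N; exact: nbhs_infty_ge.
apply: (@le_trans _ _ (normc (\sum_(j <- box_seq n N) (h j)%:C%C))).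
  rewrite -(rmorph_sum (real_complex R)) normc_real ?sumr_ge0//.
  by rewrite (bigD1_seq k)//= ?box_seq_uniq// lerDl sumr_ge0.
rewrite -[X in normc X](subrK (sumZ (fun j => (h j)%:C%C))) addrC.
apply: le_trans (le_normcD _ _) _; rewrite lerD2l -normcN opprB ltW//.
by near: N; exact: ch.
Unshelve. all: by end_near. Qed.

(** The numbers [d k] are the tails, for [lattice_le], of the sum of a sequence
    [g], so that the difference of two of them is at least the value of [g] at
    the smaller index.  For [g] rapidly decaying, so is [d]; taking for [g j] a
    bound of the square roots of the entries in the row and the column [j], the
    division by [d k - d l] costs a square root. *)
Lemma zero_diagonal_commutator r : rapid_matrix r -> (forall k, r k k = 0) ->
  exists (d : Zn n -> R[i]) b, [/\ rapidly_decaying d, rapid_matrix b &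
    forall k l, r k l = (d k - d l) * b k l].
Proof.
move=> rr r0.
pose h j l := Num.sqrt (normc (r j l)) + Num.sqrt (normc (r l j)).
have h0 j l : 0 <= h j l by rewrite addr_ge0 ?sqrtr_ge0.
have sqrt_bound p : exists M, 0 < M /\ forall k l,
    weight R k ^+ p * h k l <= M.
  have [M rM] := rr (p * 2)%N 0%N; have [L rL] := rr 0%N (p * 2)%N.
  have M0 : 0 <= M by apply: le_trans (rM 0 0);
    rewrite ?mulr_ge0 ?exprn_ge0 ?weight_ge0 ?normc_ge0.
  have L0 : 0 <= L by apply: le_trans (rL 0 0);
    rewrite ?mulr_ge0 ?exprn_ge0 ?weight_ge0 ?normc_ge0.
  exists (1 + M + (1 + L)); split; first by rewrite ltr_wpDr ?ltr_pwDl ?addr_ge0.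
  move=> k l; rewrite /h mulrDr lerD//; apply: sqr_le_bound;
    rewrite exprMn sqr_sqrtr ?normc_ge0// -exprM.
    by have := rM k l; rewrite expr0 mulr1.
  by have := rL l k; rewrite expr0 mul1r.
pose g j := sup (range (h j)).
have hg j l : h j l <= g j.
  apply: ub_le_sup; last by exists l.
  have [M [_ hM]] := sqrt_bound 0%N; exists M => _ [i _ <-].
  by have := hM j i; rewrite expr0 mul1r.
have g0 j : 0 <= g j by apply: le_trans (hg j 0).
have gM p : exists M, 0 < M /\ forall j, weight R j ^+ p * g j <= M.
  have [M [M0 hM]] := sqrt_bound p; exists M; split=> // j.
  have wj : 0 < weight R j ^+ p by rewrite exprn_gt0// weight_gt0.
  rewrite mulrC -ler_pdivlMr//; apply: ge_sup; first by exists (h j 0), 0.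
  by move=> _ [l _ <-]; rewrite ler_pdivlMr// mulrC.
pose c k j : R := if lattice_le k j then g j else 0.
have c0 k j : 0 <= c k j by rewrite /c; case: ifP.
(* Indices beyond [k] have a larger weight, so [g] may lend its decay to [k]. *)
have cM p : exists M, forall k j,
    normc (c k j)%:C%C <= M * (weight R k ^+ p)^-1 * (weight R j ^+ (2 * n))^-1.
  have [M [M0 gMp]] := gM (p + 2 * n)%N; exists M => k j; rewrite normc_real//.
  rewrite /c; case: ifP => [/lattice_le_weight kj|_]; last first.
    by rewrite !mulr_ge0 ?invr_ge0 ?exprn_ge0 ?weight_ge0// ltW.
  rewrite ler_pdivlMr ?exprn_gt0 ?weight_gt0// ler_pdivlMr ?exprn_gt0 ?weight_gt0//.
  apply: le_trans (gMp j).
  have -> : weight R j ^+ (p + 2 * n) * g j =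
      g j * weight R j ^+ (2 * n) * weight R j ^+ p by rewrite exprD; ring.
  rewrite ler_wpM2l ?mulr_ge0 ?exprn_ge0 ?weight_ge0//.
  by rewrite lerXn2r ?nnegrE ?weight_ge0.
have sc k : summable_family (fun j => (c k j)%:C%C).
  have [M kM] := cM 0%N; exists (M * (weight R k ^+ 0)^-1 * 4 ^+ n).
  exact: weight_dominated.
pose d k := sumZ (fun j => (c k j)%:C%C).
have rd : rapidly_decaying d.
  move=> p; have [M dM] := cM p; exists (M * 4 ^+ n) => k.
  have wk : 0 < weight R k ^+ p by rewrite exprn_gt0// weight_gt0.
  rewrite -[X in X ^+ p]/(weight R k) mulrC -ler_pdivlMr// mulrAC.
  by apply: normc_sumZ_le; apply: weight_dominated.
have dgap k l : lattice_le k l -> ~~ lattice_le l k -> g k <= normc (d k - d l).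
  move=> kl lk.
  have e0 j : 0 <= c k j - c l j.
    rewrite subr_ge0 /c; case: ifP => [lj|_]; last by case: ifP.
    by rewrite (lattice_le_trans kl lj).
  have sd : summable_family (fun j => (c k j)%:C%C + (-1) * (c l j)%:C%C).
    by apply: summable_familyD => //; exact: summable_familyZ.
  have cE j : (c k j)%:C%C + (-1) * (c l j)%:C%C = (c k j - c l j)%:C%C :> R[i].
    by rewrite mulN1r rmorphB.
  have -> : d k - d l = sumZ (fun j => (c k j - c l j)%:C%C).
    rewrite -(eq_sumZ cE) sumZD//; last exact: summable_familyZ.
    by rewrite sumZZ// mulN1r.
  have -> : g k = c k k - c l k.
    by rewrite /c lattice_le_refl (negbTE lk) subr0.
  apply: (real_term_le_sumZ k e0).
  by under eq_fun do rewrite -cE.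
have rd2 k l : normc (r k l) <= normc (d k - d l) ^+ 2.
  have [->|kl] := eqVneq k l; first by rewrite r0 normc0 sqr_ge0.
  rewrite -(sqr_sqrtr (normc_ge0 (r k l))) lerXn2r ?nnegrE ?sqrtr_ge0 ?normc_ge0//.
  have /orP[/andP[kl1 kl2]|/andP[kl1 kl2]] := lattice_le_total kl.
    apply: le_trans (dgap _ _ kl1 kl2); apply: le_trans (hg k l).
    by rewrite lerDl sqrtr_ge0.
  rewrite -[leRHS]normcN opprB; apply: le_trans (dgap _ _ kl1 kl2).
  by apply: le_trans (hg l k); rewrite lerDr sqrtr_ge0.
exists d, (fun k l => (d k - d l)^-1 * r k l); split=> //; last first.
  move=> k l; have [e|e] := eqVneq (d k - d l) 0; last by rewrite mulVKf.
  have := rd2 k l; rewrite e normc0 expr0n/= mul0r => rl.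
  by apply: eq0_normc; apply/eqP; rewrite eq_le rl normc_ge0.
apply: rapid_matrix_sqrt rr _ => k l; rewrite normcM normcV exprMn exprVn.
have [e|e] := eqVneq (normc (d k - d l)) 0.
  by rewrite e expr0n/= invr0 mul0r normc_ge0.
have e2 : 0 < normc (d k - d l) ^+ 2 by rewrite lt0r sqrf_eq0 e sqr_ge0.
by rewrite mulrC ler_pdivrMr// [leLHS]expr2 ler_wpM2l ?normc_ge0.
Qed.

End Commutators.

Section Trace.
Context (R : realType) (n : nat) (theta : 'M[R]_n).
Implicit Types (k l : Zn n) (u v : smooth theta).
Implicit Types (t b : Zn n -> Zn n -> R[i]).

Lemma inner_Ubasis u k : inner theta u (Ubasis theta k) = u k.
Proof.
rewrite /inner /tau /tmul (sumZ_single (k := k)) /tstar /=; last first.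
  move=> j jk; rewrite sub0r opprK (negbTE jk) mulr0.
  have -> : (0^*)%C = 0 :> R[i] by apply/eqP; rewrite eq_complex/= oppr0 !eqxx.
  by rewrite mulr0.
rewrite sub0r opprK eqxx mulr1 mulrAC /cocycle /expi.
set a := 2 * pi * _; rewrite -[RHS]mul1r; congr (_ * _).
apply/eqP; rewrite eq_complex /=; apply/andP; split; apply/eqP.
  by rewrite mulrN opprK -!expr2 cos2Dsin2.
by rewrite mulrN mulrC addNr.
Qed.

Lemma matrix_action_Ubasis t k l : matrix_action t (Ubasis theta l) k = t k l.
Proof.
rewrite /matrix_action (sumZ_single (k := l)) /= ?eqxx ?mulr1// => j jl.
by rewrite (negbTE jl) mulr0.
Qed.

Lemma Tr_matrix (T : {linear smooth theta -> smooth_dual theta}) t :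
  (forall u k, corestr T u k = matrix_action t u k) ->
  Tr T = sumZ (fun k => t k k).
Proof.
by move=> Tt; apply: eq_sumZ => k; rewrite inner_Ubasis Tt matrix_action_Ubasis.
Qed.

Lemma matrix_action_outer (x y : Zn n -> R[i]) u k :
  rapidly_decaying x -> rapidly_decaying y ->
  matrix_action (fun k l => x k * y l) u k = x k * sumZ (fun l => y l * u l).
Proof.
move=> rx ry; rewrite -sumZZ; last first.
  have ru := matrix_action_summable u 0 (rapid_outer (@rapid_delta R n) ry).
  by move: ru; under eq_fun do rewrite eqxx mul1r.
by apply: eq_sumZ => l; rewrite mulrA.
Qed.

Lemma matrix_action_diagonal (d : Zn n -> R[i]) u k :
  matrix_action (fun k l => (k == l)%:R * d k) u k = d k * u k.
Proof.
rewrite /matrix_action (sumZ_single (k := k)) ?eqxx ?mul1r// => l lk.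
by rewrite eq_sym (negbTE lk) !mul0r.
Qed.

(** The first summand is [[D, B]] and the other two are [[C, E]], for the column
    [C] and the row [E] through the origin.  Vanishing of the trace enters only at
    the entry [(0, 0)]: it gives [<y, x> = - t 0 0]. *)
Lemma trace_zero_commutators t : rapid_matrix t -> sumZ (fun k => t k k) = 0 ->
  exists (x y d : Zn n -> R[i]) b, [/\ rapidly_decaying x, rapidly_decaying y, rapidly_decaying d,
    rapid_matrix b & forall k l,
      t k l = (d k - d l) * b k l + x k * y l -
              (k == 0)%:R * (sumZ (fun j => y j * x j) * (l == 0)%:R)].
Proof.
move=> rt t0; have ra := rapid_diagonal_part rt.
have sa : summable_family (fun k => t k k).
  have [M aM] := ra (2 * n)%N; exists (M * 4 ^+ n); apply: weight_dominated => k.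
  exact: (@decay_coef_le R n _ _ (fun k => t k k) k aM).
pose a' k : R[i] := t k k - (k == 0)%:R * t 0 0.
have ra' : rapidly_decaying a'.
  move=> p; have [M aM] := ra p; exists M => k; apply: le_trans (aM k).
  rewrite ler_wpM2l ?exprn_ge0 ?(weight_ge0 R k)// /a'.
  have [->|_] := eqVneq k 0; first by rewrite mul1r subrr normc0 normc_ge0.
  by rewrite mul0r subr0.
have [x [y [rx ry xy]]] := rapidly_decaying_factor ra'.
have sxy : sumZ (fun j => y j * x j) = - t 0 0.
  rewrite (eq_sumZ (g := fun j => t j j + (-1) * ((j == 0)%:R * t 0 0))); last first.
    by move=> j; rewrite mulrC xy /a' mulN1r.
  have sd : summable_family (fun j => (j == 0)%:R * t 0 0 : R[i]).
    exists (normc (t 0 0)) => N; rewrite (bigD1_seq 0)/= ?box_seq_uniq//; last first.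
      by apply: mem_box_seq_norm; rewrite big1// => j _; rewrite ffunE.
    rewrite eqxx mul1r big1 ?addr0// => j j0.
    by rewrite (negbTE j0) mul0r normc0.
  rewrite sumZD//; last exact: summable_familyZ.
  rewrite t0 add0r sumZZ// (sumZ_single (k := 0)) ?eqxx ?mul1r ?mulN1r// => j j0.
  by rewrite (negbTE j0) mul0r.
pose r k l := t k l + (- x k) * y l + (k == 0)%:R * (- t 0 0 * (l == 0)%:R).
have rd := @rapid_delta R n.
have rr : rapid_matrix r.
  apply: rapid_matrixD; last by apply: rapid_outer => //; exact: rapidly_decayingZ.
  apply: rapid_matrixD => //; apply: rapid_outer => //.
  by move=> p; have [M xM] := rx p; exists M => k; rewrite normcN.
have r0 k : r k k = 0.
  rewrite /r mulNr xy /a'; by have [->|_] := eqVneq k 0; rewrite /=; ring.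
have [d [b [rd' rb rE]]] := zero_diagonal_commutator rr r0.
exists x, y, d, b; split=> // k l.
by rewrite -rE /r sxy; ring.
Qed.

End Trace.

Theorem proposition6p2 (R : realType) (n : nat) (n_ge2 : (2 <= n)%N)
    (theta : 'M[R]_n) (theta_asym : theta^T = - theta)
    (T : {linear smooth theta -> smooth_dual theta}) :
  smoothing T -> Tr T = 0 ->
  exists T1 T2 T3 T4 : {linear smooth theta -> smooth_dual theta},
    [/\ smoothing T1, smoothing T2, smoothing T3, smoothing T4 &
        forall u : smooth theta,
          T u = commutator T1 T2 u + commutator T3 T4 u].
Proof.
move=> sT; have [t rt Tt] := smoothing_matrix theta_asym sT.
rewrite (Tr_matrix Tt) => t0.
have [x [y [d [b [rx ry rd rb tE]]]]] := trace_zero_commutators rt t0.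
have rdelta := @rapid_delta R n.
have [T1 sT1 T1E] := matrix_smoothing theta_asym (rapid_diagonal rd).
have [T2 sT2 T2E] := matrix_smoothing theta_asym rb.
have [T3 sT3 T3E] := matrix_smoothing theta_asym (rapid_outer rx rdelta).
have [T4 sT4 T4E] := matrix_smoothing theta_asym (rapid_outer rdelta ry).
exists T1, T2, T3, T4; split=> // u; rewrite /commutator.
rewrite (smoothing_embed theta_asym sT) !(smoothing_embed theta_asym sT1).
rewrite !(smoothing_embed theta_asym sT2) !(smoothing_embed theta_asym sT3).
rewrite !(smoothing_embed theta_asym sT4) -!linearB -linearD; congr embed.
apply: smooth_eqP => k.
rewrite smooth_addE !smooth_subE Tt T1E matrix_action_diagonal !T2E.
rewrite T3E (matrix_action_outer _ _ rx rdelta) T4E (matrix_action_outer _ _ rdelta ry).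
have delta_sum (v : smooth theta) : sumZ (fun l => (l == 0)%:R * v l) = v 0 :> R[i].
  rewrite (sumZ_single (k := 0)) ?eqxx ?mul1r// => l l0.
  by rewrite (negbTE l0) mul0r.
rewrite delta_sum T4E (matrix_action_outer _ _ rdelta ry) eqxx mul1r.
have T3u (v : smooth theta) l : corestr T3 v l = x l * v 0.
  by rewrite T3E (matrix_action_outer _ _ rx rdelta) delta_sum.
have sy (v : smooth theta) : summable_family (fun l => y l * v l).
  have := matrix_action_summable v 0 (rapid_outer rdelta ry).
  by under eq_fun do rewrite eqxx mul1r.
have sx : summable_family (fun l => y l * x l).
  have xP : (x : Zn n -> R[i]^o) \in @rapid_pred R n by exact/asboolP.
  exact: (sy (Smooth theta xP)).
have -> : sumZ (fun l => y l * corestr T3 u l) = u 0 * sumZ (fun l => y l * x l).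
  by rewrite -sumZZ//; apply: eq_sumZ => l; rewrite T3u; ring.
have sb (v : smooth theta) : summable_family (fun l => b k l * v l).
  exact: matrix_action_summable v k rb.
have sT1u : summable_family (fun l => b k l * (d l * u l)).
  have := sb (corestr T1 u).
  by under eq_fun do rewrite T1E matrix_action_diagonal.
have -> : matrix_action b (corestr T1 u) k = sumZ (fun l => b k l * (d l * u l)).
  by apply: eq_sumZ => l; rewrite T1E matrix_action_diagonal.
have sd : summable_family (fun l => (l == 0)%:R * u l : R[i]).
  have := matrix_action_summable u 0 (rapid_outer rdelta rdelta).
  by under eq_fun do rewrite eqxx mul1r.
pose s := sumZ (fun l => y l * x l).
rewrite /matrix_action (eq_sumZ (g := fun l => (d k * (b k l * u l) +
  (-1) * (b k l * (d l * u l))) + (x k * (y l * u l) +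
  (- ((k == 0)%:R * s)) * ((l == 0)%:R * u l)))); last first.
  by move=> l; rewrite tE -/s; ring.
rewrite sumZD; last 2 first.
- by apply: summable_familyD; exact: summable_familyZ.
- by apply: summable_familyD; exact: summable_familyZ.
rewrite !sumZD; try exact: summable_familyZ.
by rewrite !sumZZ// delta_sum -/s; ring.
Qed.
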